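(* Let $\mu^\pm$ be probability measures on $\mathbb{R}^d$ with compact supports $X^\pm$, and let $c\in\mathscr{C}(X^-\times X^+)$. Then the function $\varepsilon\mapsto v_\varepsilon$ is continuous, non-decreasing and concave on $[0,+\infty)$, and it is analytic on $(0,+\infty)$.
   Context: Let $\Pi(\mu^-,\mu^+)$ be the set of probability measures on $X^-\times X^+$ with marginals $\mu^-$ and $\mu^+$. For probability measures $p,q$, $\mathrm{Ent}(p\,|\,q)=\int \rho\log\rho\,\mathrm{d}q$ if $p=\rho q$, and $+\infty$ otherwise. For $\varepsilon>0$, $v_\varepsilon \coloneqq \inf_{\gamma\in\Pi(\mu^-,\mu^+)}\{\int c\,\mathrm{d}\gamma + \varepsilon\,\mathrm{Ent}(\gamma\,|\,\mu^-\otimes\mu^+)\}$, and $v_0\coloneqq \inf_{\gamma\in\Pi(\mu^-,\mu^+)}\int c\,\mathrm{d}\gamma$. *)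

(* Defs.v *)
From HB Require Import structures.
From mathcomp Require Import all_boot all_order all_algebra.
From mathcomp Require Import all_classical all_reals all_analysis.
Set Implicit Arguments.
Unset Strict Implicit.
Unset Printing Implicit Defensive.
Import Order.TTheory GRing.Theory Num.Theory.
Import numFieldNormedType.Exports.
Local Open Scope classical_set_scope.
Local Open Scope ring_scope.

Section defs.
Context {R : realType}.

(** Points of R^d are represented as d-tuples of reals; the measurable
    structure on [d.-tuple R] is the product (= Borel) sigma-algebra.
    The (Euclidean) topology of R^d is that of row vectors ['rV[R]_d];
    [toRow] is the canonical identification. *)
Definition toRow (d : nat) (x : d.-tuple R) : 'rV[R]_d := \row_i tnth x i.

Definition msupport (d : nat) (mu : set (d.-tuple R) -> \bar R) : set 'rV[R]_d :=
  [set x | forall U : set 'rV[R]_d, open U -> U x ->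
     (0 < mu (@toRow d @^-1` U))%E].

Definition is_density d (T : measurableType d)
    (p q : {measure set T -> \bar R}) (rho : T -> R) : Prop :=
  (forall x, 0 <= rho x) /\ measurable_fun setT rho /\
  forall A, measurable A -> p A = (\int[q]_(x in A) (rho x)%:E)%E.

(** Relative entropy Ent(p | q) = \int rho log rho dq if p = rho q, +oo otherwise
    (with the convention 0 log 0 = 0; note [ln 0 = 0] in MathComp). *)
Definition Ent d (T : measurableType d)
    (p q : {measure set T -> \bar R}) : \bar R :=
  match pselect (exists rho, is_density p q rho) with
  | left h => let rho := projT1 (cid h) in
              (\int[q]_x (rho x * ln (rho x))%:E)%E
  | right _ => +oo%E
  end.

Definition coupling (d : nat) (mum mup : probability (d.-tuple R) R)
    (g : probability (d.-tuple R * d.-tuple R)%type R) : Prop :=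
  (forall A, measurable A -> g (A `*` setT) = mum A) /\
  (forall B, measurable B -> g (setT `*` B) = mup B).

Definition cost (d : nat) (Xm Xp : set 'rV[R]_d) (c : 'rV[R]_d * 'rV[R]_d -> R)
    (g : probability (d.-tuple R * d.-tuple R)%type R) : \bar R :=
  (\int[g]_(z in (@toRow d @^-1` Xm) `*` (@toRow d @^-1` Xp))
      (c (toRow z.1, toRow z.2))%:E)%E.

Definition v_ent (d : nat) (mum mup : probability (d.-tuple R) R)
    (Xm Xp : set 'rV[R]_d) (c : 'rV[R]_d * 'rV[R]_d -> R) (eps : R) : \bar R :=
  ereal_inf [set (cost Xm Xp c g + eps%:E * Ent g (mum \x mup))%E
            | g in [set g | coupling mum mup g]].

Definition v_ot (d : nat) (mum mup : probability (d.-tuple R) R)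
    (Xm Xp : set 'rV[R]_d) (c : 'rV[R]_d * 'rV[R]_d -> R) : \bar R :=
  ereal_inf [set cost Xm Xp c g | g in [set g | coupling mum mup g]].

Definition v_fun (d : nat) (mum mup : probability (d.-tuple R) R)
    (Xm Xp : set 'rV[R]_d) (c : 'rV[R]_d * 'rV[R]_d -> R) (eps : R) : \bar R :=
  if eps == 0 then v_ot mum mup Xm Xp c else v_ent mum mup Xm Xp c eps.

Definition nondecreasing_on (f : R -> R) (D : set R) : Prop :=
  forall x y, D x -> D y -> x <= y -> f x <= f y.

Definition concave_on (f : R -> R) (D : set R) : Prop :=
  forall x y t, D x -> D y -> 0 <= t <= 1 ->
    (1 - t) * f x + t * f y <= f ((1 - t) * x + t * y).

Definition analytic_on (f : R -> R) (D : set R) : Prop :=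
  forall x0, D x0 -> exists r : R, 0 < r /\ exists a : nat -> R,
    forall x, `|x - x0| < r ->
      series (fun k => a k * (x - x0) ^+ k) @ \oo --> f x.

End defs.

(* Main.v *)
Require Import Defs.
From HB Require Import structures.
From mathcomp Require Import all_boot all_order all_algebra.
From mathcomp Require Import finmap.
From mathcomp Require Import all_classical all_reals all_analysis.
From mathcomp Require Import measurable_realfun ring lra.
Set Implicit Arguments.
Unset Strict Implicit.
Unset Printing Implicit Defensive.
Import Order.TTheory GRing.Theory Num.Theory.
Import numFieldNormedType.Exports.
Local Open Scope classical_set_scope.
Local Open Scope ring_scope.

(** Extending [c] by zero off the supports, the cost becomes the integral of a
    bounded function on a product of two probability spaces.  For each [eps] the
    objective is affine in [eps] with slope [Ent >= 0], so its infimum is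
    nondecreasing and concave.  Continuity at [0] follows by replacing a coupling
    with a block-product coupling of finite entropy on small cells.

    For analyticity put [s = 1 / eps].  If [a], [b] solve the Schroedinger system
    [a(x) * int e^(-s c) b = 1 = b(y) * int e^(-s c) a], then [a e^(-s c) b] is the
    density of the optimal coupling, and the optimal cost is a supergradient of the
    concave function [s |-> s * v_(1/s)].  Perturbing the kernel by a power series
    in [h], the system can be solved by power series in [h] with coefficients that
    are bounded functions: each step inverts [(a, b) |-> (a + P b, b + P^* a)], a
    convergent Neumann series on functions of mean zero because the kernel [P] is
    bounded below, and a quadratic majorant gives a radius of convergence depending
    only on bounds for the kernel.  This gives existence of solutions (continuing
    from the constant kernel) as well as their analyticity in [s], so the optimal
    cost is a power series in [s] near each point; integrating it and composing
    with [eps |-> 1 / eps] concludes. *)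

(** * Absolutely summable power series *)

(** The linearized operator is singular: replacing [(a, b)] by [(l a, b / l)] changes nothing, so
    [(1, -1)] lies in its null space, and its range forces equal means on the two sides. Each order
    is therefore solved only up to an additive constant, and these constants are disposed of at the
    end, for the whole series at once. The step length is governed by [delta], a lower bound for the
    density [a e^(-s c) b]. It is [(m / M)^2] for a kernel between [m] and [M], whatever the
    solution [(a, b)]; this is why the continuation never slows down. Passing to [s] makes the
    objective [s E g c + Ent], affine in [s] with bounded slope, and makes the kernel entire in [s].
    The value is neither assumed differentiable nor expanded through a series for [ln a]:
    supergradients given by one power series determine a function up to a constant. Bounded
    measurable functions suffice throughout, with scalar majorants of their sup norms. *)

Section power_series.
Context {R : realType}.
Implicit Types (a b u M : nat -> R) (A B h : R).

(** Absolute summability with its bound, stated on partial sums: each instance sees finitely many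
    coefficients, so the property survives when a sequence agrees on every initial segment with some
    summable one. *)
Definition asum a A := forall N, \sum_(n < N) `|a n| <= A.
Definition conv a b n := \sum_(i < n.+1) a i * b (n - i)%N.
Definition ps a h := limn (series (fun n => a n * h ^+ n)).
Definition one_seq (n : nat) : R := (n == 0%N)%:R.

Lemma cvg_of_bound u (e : nat -> R) (l : R) :
  (forall n, `|u n - l| <= e n) -> e @ \oo --> 0 -> u @ \oo --> l.
Proof.
move=> ue e0; have h0 : (fun n => u n - l) @ \oo --> 0.
  apply: norm_cvg0; apply: (@squeeze_cvgr _ _ _ _ (fun=> 0) e) => //.
  - by apply: nearW => n /=; rewrite normr_ge0 ue.
  - exact: cvg_cst.
have -> : u = (fun n => (u n - l) + l) by apply: funext => n; rewrite subrK.
rewrite -[X in _ --> X]add0r; apply: cvgD => //; exact: cvg_cst.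
Qed.

Lemma lim_eq u (l : R) : u @ \oo --> l -> limn u = l.
Proof. by move=> h; apply: cvg_lim. Qed.

Lemma asum_ge0 a A : asum a A -> 0 <= A.
Proof. by move=> /(_ 0%N); rewrite big_ord0. Qed.

Lemma le_asum a b A : (forall n, `|a n| <= `|b n|) -> asum b A -> asum a A.
Proof. by move=> ab bA N; apply: le_trans (bA N); apply: ler_sum. Qed.

Lemma asumD a b A B : asum a A -> asum b B -> asum (fun n => a n + b n) (A + B).
Proof.
move=> aA bB N; apply: le_trans (lerD (aA N) (bB N)); rewrite -big_split /=.
by apply: ler_sum => i _; exact: ler_normD.
Qed.

Lemma asumZ a A B : 0 <= B -> asum a A -> asum (fun n => B * a n) (B * A).
Proof.
move=> B0 aA N; under eq_bigr do rewrite normrM (ger0_norm B0).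
by rewrite -mulr_sumr ler_wpM2l.
Qed.

Lemma asum_one : asum one_seq 1.
Proof.
case=> [|N]; first by rewrite big_ord0.
by rewrite big_ord_recl /= normr1 big1 ?addr0// => i _; rewrite normr0.
Qed.

Lemma asum_dom_cvg u M A : (forall n, `|u n| <= M n) -> asum M A -> cvgn (series u).
Proof.
move=> uM MA; have M0 n : 0 <= M n by exact: le_trans (uM n).
apply: normed_cvg; apply: (@series_le_cvg _ _ M) => //; first by move=> n /=.
apply: nondecreasing_is_cvgn.
  by apply: nondecreasing_series => n _ _; exact: M0.
exists A => _ [N _ <-]; rewrite seriesEord; apply: le_trans (MA N).
by apply: ler_sum => i _; exact: ler_norm.
Qed.

Lemma asum_dom_tail u M A : (forall n, `|u n| <= M n) -> asum M A ->
  forall N, `|series u N - limn (series u)| <= limn (series M) - series M N.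
Proof.
move=> uM MA N; have M0 n : 0 <= M n by exact: le_trans (uM n).
have cu := asum_dom_cvg uM MA.
have cM : cvgn (series M) by apply: (asum_dom_cvg (M := M) _ MA) => n; rewrite ger0_norm.
have c1 : (fun n => `|series u N - series u n|) @ \oo --> `|series u N - limn (series u)|.
  by apply: cvg_norm; apply: cvgB => //; exact: cvg_cst.
have c2 : (fun n => series M n - series M N) @ \oo --> limn (series M) - series M N.
  by apply: cvgB => //; exact: cvg_cst.
rewrite -(lim_eq c1) -(lim_eq c2); apply: ler_lim; [exact: cvgP c1|exact: cvgP c2|].
near=> n.
have Nn : (N <= n)%N by near: n; exact: nbhs_infty_ge.
rewrite distrC !sub_series_geq//.
by apply: le_trans (ler_norm_sum _ _ _) _; apply: ler_sum.
Unshelve. all: end_near. Qed.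

Lemma asum_tail0 M A : (forall n, 0 <= M n) -> asum M A ->
  (fun N => limn (series M) - series M N) @ \oo --> 0.
Proof.
move=> M0 MA.
have cM : cvgn (series M) by apply: (asum_dom_cvg (M := M) _ MA) => n; rewrite ger0_norm.
rewrite -[X in _ --> X](subrr (limn (series M))); apply: cvgB => //; exact: cvg_cst.
Qed.

Lemma asum_dom_lim u M A : (forall n, `|u n| <= M n) -> asum M A ->
  `|limn (series u)| <= A.
Proof.
move=> uM MA; have cu := asum_dom_cvg uM MA.
have c1 : (fun n => `|series u n|) @ \oo --> `|limn (series u)| by exact: cvg_norm.
rewrite -(lim_eq c1); apply: limr_le; first exact: cvgP c1.
apply: nearW => n; rewrite seriesEord; apply: le_trans (ler_norm_sum _ _ _) _.
apply: le_trans (MA n); apply: ler_sum => i _; apply: le_trans (uM i) _.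
exact: ler_norm.
Qed.

Lemma ps_dom a h n : `|h| <= 1 -> `|a n * h ^+ n| <= `|a n|.
Proof.
by move=> h1; rewrite normrM normrX ler_piMr// exprn_ile1.
Qed.

Lemma asum_norm a A : asum a A -> asum (fun n => `|a n|) A.
Proof. by move=> aA; apply: le_asum aA => n; rewrite normr_id. Qed.

Lemma ps_cvg a A h : asum a A -> `|h| <= 1 ->
  series (fun n => a n * h ^+ n) @ \oo --> ps a h.
Proof.
move=> aA h1; apply: (@asum_dom_cvg _ (fun n => `|a n|) A); last exact: asum_norm.
by move=> n; exact: ps_dom.
Qed.

Lemma ps_le a A h : asum a A -> `|h| <= 1 -> `|ps a h| <= A.
Proof.
move=> aA h1; apply: (@asum_dom_lim _ (fun n => `|a n|) A); last exact: asum_norm.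
by move=> n; exact: ps_dom.
Qed.

Lemma psD a b A B h : asum a A -> asum b B -> `|h| <= 1 ->
  ps (fun n => a n + b n) h = ps a h + ps b h.
Proof.
move=> aA bB h1; apply: lim_eq.
have -> : series (fun n => (a n + b n) * h ^+ n) =
   series (fun n => a n * h ^+ n) + series (fun n => b n * h ^+ n).
  by rewrite -seriesD; congr series; apply: funext => n; rewrite mulrDl.
by apply: cvgD; [exact: ps_cvg aA h1|exact: ps_cvg bB h1].
Qed.

Lemma psZ a A B h : asum a A -> `|h| <= 1 -> ps (fun n => B * a n) h = B * ps a h.
Proof.
move=> aA h1; apply: lim_eq.
have -> : series (fun n => B * a n * h ^+ n) = (fun N => B * series (fun n => a n * h ^+ n) N).
  apply: funext => N; rewrite !seriesEord /= mulr_sumr.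
  by apply: eq_bigr => i _; rewrite mulrA.
by apply: cvgM; [exact: cvg_cst|exact: ps_cvg aA h1].
Qed.

Lemma asum_geometric A (q : R) : 0 <= A -> 0 <= q < 1 ->
  asum (fun n => A * q ^+ n) (A * (1 - q)^-1).
Proof.
move=> A0 /andP[q0 q1] N; under eq_bigr do rewrite normrM normrX !ger0_norm//.
rewrite -mulr_sumr ler_wpM2l// -[leRHS]mul1r ler_pdivlMr ?subr_gt0//.
suff -> : (\sum_(i < N) q ^+ i) * (1 - q) = 1 - q ^+ N.
  by rewrite gerBl exprn_ge0.
elim: N => [|n IHn]; first by rewrite big_ord0 mul0r expr0 subrr.
by rewrite big_ord_recr /= mulrDl IHn exprS; ring.
Qed.

Lemma ps_one h : ps one_seq h = 1.
Proof.
apply: lim_eq; rewrite -cvg_shiftS /=.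
have -> : (fun n => series (fun n => one_seq n * h ^+ n) n.+1) = (fun=> 1).
  apply: funext => n; rewrite seriesEord /= big_ord_recl /= /one_seq expr0 mulr1.
  by rewrite big1 ?addr0// => i _; rewrite mul0r.
exact: cvg_cst.
Qed.

(** Induction on [N]: both sides gain the antidiagonal [i + j = N]. On the right, every old row
    receives one entry and the new row [N] contributes only [F N 0]. *)
Lemma sum_triangle (F : nat -> nat -> R) N :
  \sum_(n < N) \sum_(i < n.+1) F i (n - i)%N =
  \sum_(i < N) \sum_(j < N | (i + j < N)%N) F i j.
Proof.
elim: N => [|N IH]; first by rewrite !big_ord0.
rewrite big_ord_recr /= IH [RHS]big_ord_recr /=.
have -> : \sum_(j < N.+1 | (N + j < N.+1)%N) F N j = F N 0%N.
  rewrite big_mkcond big_ord_recl /= addn0 ltnSn big1 ?addr0// => i _.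
  by rewrite /bump /= add1n addnS ltnS ltnNge leq_addr.
rewrite [X in _ + X = _]big_ord_recr /= subnn addrA; congr +%R.
rewrite -big_split /=; apply: eq_bigr => i _.
rewrite [RHS]big_mkcond big_ord_recr /=.
have -> : (if (i + N < N.+1)%N then F i N else 0) = if i == 0%N :> nat then F i N else 0.
  by rewrite -[X in (_ < X)%N]add1n ltn_add2r ltnS leqn0.
have iN := ltn_ord i.
have e : \sum_(j < N) (if (i + j < N.+1)%N then F i j else 0) =
  \sum_(j < N) ((if (i + j < N)%N then F i j else 0) + (if (i + j == N)%N then F i j else 0)).
  apply: eq_bigr => j _; rewrite ltnS leq_eqVlt; case: ltngtP => //=; rewrite ?addr0 ?add0r//.
rewrite e big_split /= -big_mkcond -addrA; congr +%R.
have [i0|i0] := eqVneq (i : nat) 0%N.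
  rewrite i0 big1 ?add0r ?subn0// => j _; rewrite add0n; case: eqP => // jN.
  by have := ltn_ord j; rewrite jN ltnn.
rewrite addr0.
have lt : (N - i < N)%N by rewrite ltn_subrL lt0n i0 (leq_ltn_trans _ iN).
rewrite (bigD1 (Ordinal lt)) //= subnKC ?eqxx ?(ltnW iN)// big1 ?addr0// => j jne.
case: eqP => // ijN; case/eqP: jne; apply: val_inj => /=.
by rewrite -[X in (X - _)%N]ijN addKn.
Qed.

Lemma asum_conv a b A B : asum a A -> asum b B -> asum (conv a b) (A * B).
Proof.
move=> aA bB N; apply: (@le_trans _ _ (\sum_(n < N) \sum_(i < n.+1) `|a i| * `|b (n - i)%N|)).
  apply: ler_sum => n _; apply: le_trans (ler_norm_sum _ _ _) _.
  by apply: ler_sum => i _; rewrite normrM.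
rewrite (sum_triangle (fun i j => `|a i| * `|b j|)).
apply: (@le_trans _ _ (\sum_(i < N) `|a i| * B)).
  apply: ler_sum => i _; rewrite -mulr_sumr ler_wpM2l//; apply: le_trans (bB N).
  by rewrite big_mkcond; apply: ler_sum => j _; case: ifP.
by rewrite -mulr_suml ler_wpM2r// (asum_ge0 bB).
Qed.

(** The product of partial sums runs over a square and the convolution over its lower triangle. The
    missing pairs have [i + j >= N], so they cost at most [A * B * |h|^N]; this is where [|h| < 1]
    must be strict. *)
Lemma ps_conv a b A B h : asum a A -> asum b B -> `|h| < 1 ->
  ps (conv a b) h = ps a h * ps b h.
Proof.
move=> aA bB h1; have h1' := ltW h1; apply: lim_eq.
have c : (fun N => series (fun n => a n * h ^+ n) N * series (fun n => b n * h ^+ n) N)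
    @ \oo --> ps a h * ps b h.
  by apply: cvgM; [exact: ps_cvg aA h1'|exact: ps_cvg bB h1'].
have d : (fun N => series (fun n => conv a b n * h ^+ n) N
     - series (fun n => a n * h ^+ n) N * series (fun n => b n * h ^+ n) N) @ \oo --> 0.
  apply: (@cvg_of_bound _ (fun N => A * B * `|h| ^+ N)); last first.
    rewrite -(mulr0 (A * B)); apply: cvgM; first exact: cvg_cst.
    by apply: cvg_expr; rewrite normr_id.
  move=> N; rewrite subr0 !seriesEord /= distrC.
  have -> : \sum_(n < N) conv a b n * h ^+ n =
     \sum_(i < N) \sum_(j < N | (i + j < N)%N) (a i * h ^+ i) * (b j * h ^+ j).
    rewrite -(sum_triangle (fun i j => (a i * h ^+ i) * (b j * h ^+ j))).
    apply: eq_bigr => n _; rewrite /conv mulr_suml; apply: eq_bigr => i _.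
    by rewrite mulrACA -exprD subnKC// -ltnS.
  rewrite mulr_suml -sumrB.
  apply: (@le_trans _ _ (\sum_(i < N) \sum_(j < N) `|a i| * `|b j| * `|h| ^+ N)).
    apply: le_trans (ler_norm_sum _ _ _) _; apply: ler_sum => i _.
    rewrite mulr_sumr [X in _ - X]big_mkcond -sumrB.
    apply: le_trans (ler_norm_sum _ _ _) _; apply: ler_sum => j _.
    case: ltnP => ij; first by rewrite subrr normr0 !mulr_ge0// exprn_ge0.
    rewrite subr0 mulrACA -exprD !normrM normrX ler_wpM2l ?mulr_ge0//.
    exact: ler_wiXn2l.
  under eq_bigr do rewrite -mulr_suml -mulr_sumr.
  rewrite -!mulr_suml ler_wpM2r ?exprn_ge0//.
  by apply: ler_pM; [exact: sumr_ge0|exact: sumr_ge0|exact: aA|exact: bB].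
rewrite -[X in _ --> X]add0r.
have -> : series (fun n => conv a b n * h ^+ n) =
   (fun N => (series (fun n => conv a b n * h ^+ n) N - series (fun n => a n * h ^+ n) N *
    series (fun n => b n * h ^+ n) N) +
     series (fun n => a n * h ^+ n) N * series (fun n => b n * h ^+ n) N).
  by apply: funext => N; rewrite subrK.
exact: cvgD d c.
Qed.

Lemma conv0 a b : conv a b 0%N = a 0%N * b 0%N.
Proof. by rewrite /conv big_ord_recl big_ord0 addr0. Qed.

Lemma convDl a a' b n : conv (fun n => a n + a' n) b n = conv a b n + conv a' b n.
Proof. by rewrite /conv -big_split /=; apply: eq_bigr => i _; rewrite mulrDl. Qed.

Lemma convDr a b b' n : conv a (fun n => b n + b' n) n = conv a b n + conv a b' n.
Proof. by rewrite /conv -big_split /=; apply: eq_bigr => i _; rewrite mulrDr. Qed.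

Lemma conv1l b n : conv one_seq b n = b n.
Proof.
rewrite /conv big_ord_recl /= /one_seq mul1r subn0 big1 ?addr0// => i _.
by rewrite mul0r.
Qed.

Lemma conv1r a n : conv a one_seq n = a n.
Proof.
rewrite /conv big_ord_recr /= /one_seq subnn mulr1 big1 ?add0r// => i _.
by rewrite subn_eq0 leqNgt ltn_ord mulr0.
Qed.

Lemma le_conv a b (A B : nat -> R) n : (forall n, `|a n| <= A n) -> (forall n, `|b n| <= B n) ->
  `|conv a b n| <= conv A B n.
Proof.
move=> aA bB; apply: le_trans (ler_norm_sum _ _ _) _; apply: ler_sum => i _.
by rewrite normrM ler_pM.
Qed.

Lemma conv_eq a a' b b' n : (forall i, (i <= n)%N -> a i = a' i) ->
  (forall i, (i <= n)%N -> b i = b' i) -> conv a b n = conv a' b' n.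
Proof.
move=> ea eb; apply: eq_bigr => i _.
by rewrite ea ?eb ?leq_subr// -ltnS.
Qed.

(* The factor of index [n] only occurs against the vanishing coefficient. *)
Lemma conv_causal a a' b b' n : a 0%N = 0 -> b 0%N = 0 -> a' 0%N = 0 -> b' 0%N = 0 ->
  (forall i, (i < n)%N -> a i = a' i) -> (forall i, (i < n)%N -> b i = b' i) ->
  conv a b n = conv a' b' n.
Proof.
move=> a0 b0 a0' b0' ea eb; apply: eq_bigr => -[i ilt] _ /=.
have [->|i0] := eqVneq i 0%N; first by rewrite a0 a0' !mul0r.
have [->|iN] := eqVneq i n; first by rewrite subnn b0 b0' !mulr0.
rewrite ea ?eb ?ltn_subrL ?lt0n ?i0//=; first by case: n i0 iN ilt {ea eb} => //; case: i.
by rewrite ltn_neqAle iN -ltnS.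
Qed.

Lemma conv_causal0l a b b' n : a 0%N = 0 ->
  (forall i, (i < n)%N -> b i = b' i) -> conv a b n = conv a b' n.
Proof.
move=> a0 eb; apply: eq_bigr => -[i ilt] _ /=.
have [->|i0] := eqVneq i 0%N; first by rewrite a0 !mul0r.
rewrite eb ?ltn_subrL ?lt0n ?i0//=.
by case: n i0 ilt {eb} => //; case: i.
Qed.

Lemma conv_causal0r a a' b n : b 0%N = 0 ->
  (forall i, (i < n)%N -> a i = a' i) -> conv a b n = conv a' b n.
Proof.
move=> b0 ea; apply: eq_bigr => -[i ilt] _ /=.
have [->|iN] := eqVneq i n; first by rewrite subnn b0 !mulr0.
by rewrite ea// ltn_neqAle iN -ltnS.
Qed.

End power_series.

(** * Integrals of bounded measurable functions *)

Section bounded_measurable.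
Context {R : realType}.

(** This class is stable under algebra, sections and partial integration, and lies in L1 of every
    probability, so integrability never has to be tracked separately. *)
Definition bm d (T : measurableType d) (f : T -> R) :=
  measurable_fun setT f /\ exists M : R, forall x, `|f x| <= M.

Context d (T : measurableType d).
Implicit Types f g : T -> R.

Lemma bm_cst (r : R) : bm (fun _ : T => r).
Proof. by split => //; exists `|r|. Qed.

Lemma bmD f g : bm f -> bm g -> bm (fun x => f x + g x).
Proof.
move=> [mf [M fM]] [mg [N gN]]; split; first exact: measurable_funD.
by exists (M + N) => x; apply: le_trans (ler_normD _ _) _; exact: lerD.
Qed.

Lemma bmM f g : bm f -> bm g -> bm (fun x => f x * g x).
Proof.
move=> [mf [M fM]] [mg [N gN]]; split; first exact: measurable_funM.
by exists (M * N) => x; rewrite normrM ler_pM.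
Qed.

Lemma bmZ r f : bm f -> bm (fun x => r * f x).
Proof. by apply: bmM; exact: bm_cst. Qed.

Lemma bmN f : bm f -> bm (fun x => - f x).
Proof. by move=> /(bmZ (-1)); congr bm; apply: funext => x; rewrite mulN1r. Qed.

Lemma bmB f g : bm f -> bm g -> bm (fun x => f x - g x).
Proof. by move=> bf bg; apply: bmD => //; exact: bmN. Qed.

Lemma bm_sum (I : Type) (s : seq I) (F : I -> T -> R) :
  (forall i, bm (F i)) -> bm (fun x => \sum_(i <- s) F i x).
Proof.
move=> bF; elim: s => [|i s IH].
  have -> : (fun x => \sum_(i <- [::]) F i x) = fun=> 0.
    by apply: funext => x; rewrite big_nil.
  exact: bm_cst.
have -> : (fun x => \sum_(j <- i :: s) F j x) = fun x => F i x + \sum_(j <- s) F j x.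
  by apply: funext => x; rewrite big_cons.
exact: bmD.
Qed.

Lemma bm_comp d' (T' : measurableType d') (h : T' -> T) f :
  measurable_fun setT h -> bm f -> bm (f \o h).
Proof.
move=> mh [mf [M fM]]; split; first exact: measurableT_comp.
by exists M => x; exact: fM.
Qed.

Lemma bm_inv f (m : R) : 0 < m -> (forall x, m <= f x) -> bm f -> bm (fun x => (f x)^-1).
Proof.
move=> m0 mf [f' _]; split.
  have -> : (fun x => (f x)^-1) = (fun x => expR (- ln (f x))).
    by apply: funext => x /=; rewrite expRN lnK// posrE (lt_le_trans m0).
  apply: measurableT_comp => //; apply: measurable_funN; exact: measurableT_comp.
exists m^-1 => x; have fx : 0 < f x by exact: lt_le_trans (mf x).
by rewrite ger0_norm ?lef_pV2// invr_ge0 ltW.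
Qed.

Lemma bm_ln f (m : R) : 0 < m -> (forall x, m <= f x) -> bm f -> bm (fun x => ln (f x)).
Proof.
move=> m0 mf [f' [M fM]]; split; first exact: measurableT_comp.
exists (Num.max `|ln m| `|ln M|) => x.
have fx : 0 < f x by exact: lt_le_trans (mf x).
have l1 : ln m <= ln (f x) by rewrite ler_ln.
have M0 : 0 < M by apply: lt_le_trans fx _; apply: le_trans (fM x); exact: ler_norm.
have l2 : ln (f x) <= ln M by rewrite ler_ln//; apply: le_trans (fM x); exact: ler_norm.
rewrite ler_norml; apply/andP; split.
  rewrite lerNl le_max; apply/orP; left; apply: le_trans (_ : - ln m <= _).
    by rewrite lerN2.
  by rewrite -normrN ler_norm.
by apply: le_trans l2 _; rewrite le_max ler_norm orbT.
Qed.

Lemma bm_expR f : bm f -> bm (fun x => expR (f x)).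
Proof.
move=> [mf [M fM]]; split; first by apply: measurableT_comp.
exists (expR M) => x; rewrite ger0_norm ?expR_ge0// ler_expR.
by apply: le_trans (fM x); exact: ler_norm.
Qed.

Lemma bm_lim (F : nat -> T -> R) (M : nat -> R) A : (forall n, bm (F n)) ->
  (forall n x, `|F n x| <= M n) -> asum M A -> bm (fun x => limn (series (F^~ x))).
Proof.
move=> bF FM MA; split; last first.
  by exists A => x; apply: asum_dom_lim MA => n.
apply: (@measurable_fun_cvg _ _ _ _ (fun N x => series (F^~ x) N)).
  move=> N; have [mF _] := bm_sum (index_enum 'I_N) (fun i : 'I_N => bF i).
  by apply: eq_measurable_fun mF => x _; rewrite seriesEord.
by move=> x _; apply: (@asum_dom_cvg _ _ M A).
Qed.

End bounded_measurable.

Section expectation.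
Context {R : realType} d (T : measurableType d) (mu : probability T R).
Implicit Types f g : T -> R.

Definition E f := \int[mu]_x f x.

Lemma bm_integrable f : bm f -> mu.-integrable setT (EFin \o f).
Proof.
move=> [mf [M fM]]; apply: measurable_bounded_integrable => //.
  exact: fin_num_fun_lty.
exists M; split; first exact: num_real.
by move=> N MN x _; apply: le_trans (fM x) (ltW MN).
Qed.

Lemma bm_fin f : bm f -> (\int[mu]_x (f x)%:E = (E f)%:E)%E.
Proof.
move=> bf; rewrite /E /Rintegral fineK//.
have := integrable_fin_num measurableT (bm_integrable bf); exact.
Qed.

Lemma ED f g : bm f -> bm g -> E (fun x => f x + g x) = E f + E g.
Proof. by move=> bf bg; rewrite /E RintegralD//; exact: bm_integrable. Qed.

Lemma EB f g : bm f -> bm g -> E (fun x => f x - g x) = E f - E g.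
Proof. by move=> bf bg; rewrite /E RintegralB//; exact: bm_integrable. Qed.

Lemma EZ r f : bm f -> E (fun x => r * f x) = r * E f.
Proof. by move=> bf; rewrite /E RintegralZl//; exact: bm_integrable. Qed.

Lemma EN f : bm f -> E (fun x => - f x) = - E f.
Proof.
move=> bf; rewrite -mulN1r -EZ//; congr E; apply: funext => x; by rewrite mulN1r.
Qed.

Lemma E_cst (r : R) : E (fun=> r) = r.
Proof. rewrite /E Rintegral_cst//; transitivity (r * fine 1%E); last by rewrite mulr1.
congr (r * fine _); exact: probability_setT. Qed.

Lemma le_E f g : bm f -> bm g -> (forall x, f x <= g x) -> E f <= E g.
Proof. by move=> bf bg fg; rewrite /E le_Rintegral//; exact: bm_integrable. Qed.

Lemma E_ge0 f : (forall x, 0 <= f x) -> 0 <= E f.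
Proof. by move=> f0; rewrite /E Rintegral_ge0. Qed.

Lemma E_norm f (M : R) : bm f -> (forall x, `|f x| <= M) -> `|E f| <= M.
Proof.
move=> bf fM; rewrite ler_norml; apply/andP; split.
  rewrite -(E_cst (- M)); apply: le_E => //; first exact: bm_cst.
  by move=> x; have := fM x; rewrite ler_norml => /andP[].
rewrite -(E_cst M); apply: le_E => //; first exact: bm_cst.
by move=> x; apply: le_trans (fM x); exact: ler_norm.
Qed.

Lemma E_norm_le f g : bm f -> bm g -> (forall x, `|f x| <= g x) -> `|E f| <= E g.
Proof.
move=> bf bg fg; rewrite ler_norml; apply/andP; split.
  rewrite -EN//; apply: le_E => //; first exact: bmN.
  by move=> x; have := fg x; rewrite ler_norml => /andP[].
by apply: le_E => // x; apply: le_trans (fg x); exact: ler_norm.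
Qed.

Lemma E_sum (I : Type) (s : seq I) (F : I -> T -> R) : (forall i, bm (F i)) ->
  E (fun x => \sum_(i <- s) F i x) = \sum_(i <- s) E (F i).
Proof.
move=> bF; elim: s => [|i s IH].
  rewrite big_nil -[RHS](E_cst 0); congr E; by apply: funext => x; rewrite big_nil.
rewrite big_cons -IH -ED//; last exact: bm_sum.
by congr E; apply: funext => x; rewrite big_cons.
Qed.

Lemma E_series (F : nat -> T -> R) (M : nat -> R) A : (forall n, bm (F n)) ->
  (forall n x, `|F n x| <= M n) -> asum M A ->
  series (fun n => E (F n)) @ \oo --> E (fun x => limn (series (F^~ x))).
Proof.
move=> bF FM MA.
(* A negative [M n] would force [T] to be empty, against total mass one. *)
have [M0|M0] := pselect (forall n, 0 <= M n); last first.
  have e : forall x : T, False.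
    by move=> x; apply: M0 => n; apply: le_trans (FM n x).
  have := @E_cst 1; rewrite /E /Rintegral.
  have -> : [set: T] = set0 by apply/seteqP; split => x // _; case: (e x).
  by rewrite integral_set0 /= => /eqP; rewrite eq_sym oner_eq0.
apply: (cvg_of_bound _ (asum_tail0 M0 MA)) => N.
have bl := bm_lim bF FM MA.
have bs : bm (fun x => series (F^~ x) N).
  have := bm_sum (index_enum 'I_N) (fun i : 'I_N => bF i).
  by congr bm; apply: funext => x; rewrite seriesEord.
have -> : series (fun n => E (F n)) N = E (fun x => series (F^~ x) N).
  rewrite seriesEord /= -E_sum//; congr E; by apply: funext => x; rewrite seriesEord.
rewrite -EB//; apply: E_norm; first exact: bmB.
by move=> x; apply: (@asum_dom_tail _ (F^~ x) M A _ MA N) => n.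
Qed.

Lemma E_ps (F : nat -> T -> R) (M : nat -> R) A h : (forall n, bm (F n)) ->
  (forall n x, `|F n x| <= M n) -> asum M A -> `|h| <= 1 ->
  E (fun x => ps (F^~ x) h) = ps (fun n => E (F n)) h.
Proof.
move=> bF FM MA h1; apply/esym/lim_eq.
have -> : (fun n => E (F n) * h ^+ n) = (fun n => E (fun x => F n x * h ^+ n)).
  apply: funext => n; rewrite mulrC -EZ//.
  by congr E; apply: funext => x; rewrite mulrC.
apply: (E_series (M := M) _ _ MA) => n.
  by under eq_fun do rewrite mulrC; exact: bmZ.
by move=> x; apply: le_trans (ps_dom (F^~ x) n h1) _.
Qed.

Lemma bm_ps (F : nat -> T -> R) (M : nat -> R) A h : (forall n, bm (F n)) ->
  (forall n x, `|F n x| <= M n) -> asum M A -> `|h| <= 1 -> bm (fun x => ps (F^~ x) h).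
Proof.
move=> bF FM MA h1; apply: (bm_lim (F := fun n x => F n x * h ^+ n) (M := M) _ _ MA) => n.
  by under eq_fun do rewrite mulrC; exact: bmZ.
by move=> x; apply: le_trans (ps_dom (F^~ x) n h1) _.
Qed.

End expectation.

(** * Sections, partial integrals and Fubini for bounded kernels *)

Section kernels.
Context {R : realType} d1 d2 (T1 : measurableType d1) (T2 : measurableType d2).
Implicit Types k : T1 * T2 -> R.

Lemma bm_fst (f : T1 -> R) : bm f -> bm (fun z : T1 * T2 => f z.1).
Proof. exact: (@bm_comp R _ T1 _ (T1 * T2)%type fst). Qed.

Lemma bm_snd (f : T2 -> R) : bm f -> bm (fun z : T1 * T2 => f z.2).
Proof. exact: (@bm_comp R _ T2 _ (T1 * T2)%type snd). Qed.

Lemma bm_swap k : bm k -> bm (fun z : T2 * T1 => k (z.2, z.1)).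
Proof.
apply: (@bm_comp R _ (T1 * T2)%type _ (T2 * T1)%type (fun z => (z.2, z.1))).
exact: measurable_fun_pair.
Qed.

Lemma bm_sec1 k x : bm k -> bm (fun y => k (x, y)).
Proof. by apply: (@bm_comp R _ (T1 * T2)%type _ T2 (fun y => (x, y))); exact: pair1_measurable. Qed.

Lemma bm_sec2 k y : bm k -> bm (fun x => k (x, y)).
Proof. by apply: (@bm_comp R _ (T1 * T2)%type _ T1 (fun x => (x, y))); exact: pair2_measurable. Qed.

Variables (mu : probability T1 R) (nu : probability T2 R).

Lemma bm_E2 k : bm k -> bm (fun x => E nu (fun y => k (x, y))).
Proof.
move=> bk; have [mk [M kM]] := bk; split; last first.
  by exists M => x; apply: E_norm => //; exact: bm_sec1.
have := @measurable_fubini_F _ _ T1 T2 R mu nu (EFin \o k).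
move=> /(_ (bm_integrable (mu \x nu)%E bk)) h.
apply: (measurableT_comp (f := fine)) => //.
Qed.

Lemma fubini12 k : bm k ->
  E mu (fun x => E nu (fun y => k (x, y))) = E (mu \x nu)%E k.
Proof.
move=> bk; rewrite {1}/E /Rintegral.
rewrite (eq_integral (fun x => \int[nu]_y (k (x, y))%:E)%E); last first.
  by move=> x _; rewrite bm_fin//; exact: bm_sec1.
have := @integral12_prod_meas1 _ _ T1 T2 R mu nu (EFin \o k).
by move=> /(_ (bm_integrable (mu \x nu)%E bk)) => e; congr fine.
Qed.

Lemma fubini21 k : bm k ->
  E nu (fun y => E mu (fun x => k (x, y))) = E (mu \x nu)%E k.
Proof.
move=> bk; rewrite {1}/E /Rintegral.
rewrite (eq_integral (fun y => \int[mu]_x (k (x, y))%:E)%E); last first.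
  by move=> x _; rewrite bm_fin//; exact: bm_sec2.
have := @integral21_prod_meas1 _ _ T1 T2 R mu nu (EFin \o k).
by move=> /(_ (bm_integrable (mu \x nu)%E bk)) => e; congr fine.
Qed.

End kernels.

(** * Bistochastic kernels *)

Definition swapk {R : realType} {T1 T2 : Type} (k : T1 * T2 -> R) : T2 * T1 -> R :=
  fun z => k (z.2, z.1).

Section markov.
Context {R : realType} d1 d2 (T1 : measurableType d1) (T2 : measurableType d2).
Implicit Types (mu : probability T1 R) (nu : probability T2 R) (p k : T1 * T2 -> R).

(** For [delta >= 0] this is a coupling density relative to the product measure; a positive [delta]
    is a Doeblin minorization. *)
Definition bistochastic mu nu (delta : R) p :=
  [/\ bm p, forall z, delta <= p z, forall x, E nu (fun y => p (x, y)) = 1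
    & forall y, E mu (fun x => p (x, y)) = 1].

Definition kop nu k (b : T2 -> R) (x : T1) := E nu (fun y => k (x, y) * b y).

Lemma bm_kint k b x : bm k -> bm b -> bm (fun y => k (x, y) * b y).
Proof. by move=> bk bb; apply: bmM => //; exact: bm_sec1. Qed.

Lemma bm_kop mu nu k b : bm k -> bm b -> bm (kop nu k b).
Proof.
move=> bk bb; apply: (@bm_E2 R _ _ _ _ mu nu (fun z => k z * b z.2)).
by apply: bmM => //; exact: bm_snd.
Qed.

Section bist.
Variables (mu : probability T1 R) (nu : probability T2 R) (delta : R) (p : T1 * T2 -> R).
Hypothesis bp : bistochastic mu nu delta p.

Let bmp : bm p. Proof. by case: bp. Qed.
Let p_ge z : delta <= p z. Proof. by case: bp. Qed.
Let pE1 x : E nu (fun y => p (x, y)) = 1. Proof. by case: bp. Qed.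
Let pE2 y : E mu (fun x => p (x, y)) = 1. Proof. by case: bp. Qed.

Lemma bist_delta_le1 : delta <= 1.
Proof.
pose x := point : T1.
rewrite -(pE1 x) -(E_cst nu delta); apply: le_E => //; first exact: bm_cst.
exact: bm_sec1.
Qed.

Lemma kop_cst c x : kop nu p (fun=> c) x = c.
Proof.
rewrite /kop -[RHS]mulr1 -[in RHS](pE1 x) -EZ; last exact: bm_sec1.
by congr E; apply: funext => y; rewrite mulrC.
Qed.

Lemma kopD b b' x : bm b -> bm b' -> kop nu p (fun y => b y + b' y) x = kop nu p b x + kop nu p b' x.
Proof.
move=> bb bb'; rewrite /kop -ED; [|exact: bm_kint..].
by congr E; apply: funext => y; rewrite mulrDr.
Qed.

Hypothesis delta0 : 0 <= delta.

Lemma p_ge0 z : 0 <= p z. Proof. exact: le_trans (p_ge z). Qed.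

Lemma kop_le b (M : R) : bm b -> (forall y, `|b y| <= M) -> forall x, `|kop nu p b x| <= M.
Proof.
move=> bb bM x; rewrite -[leRHS]mulr1 -(pE1 x) -EZ; last exact: bm_sec1.
apply: E_norm_le; first exact: bm_kint.
  by apply: bmZ; exact: bm_sec1.
by move=> y; rewrite normrM (ger0_norm (p_ge0 _)) mulrC ler_wpM2r// p_ge0.
Qed.

(** The column normalization makes the operator preserve means, so the Neumann iteration never
    leaves the functions of mean zero. *)
Lemma E_kop b : bm b -> E mu (kop nu p b) = E nu b.
Proof.
move=> bb; have bk : bm (fun z : T1 * T2 => p z * b z.2).
  by apply: bmM => //; exact: bm_snd.
rewrite (fubini12 mu nu bk) -(fubini21 mu nu bk); congr E.
apply: funext => y; rewrite -[RHS]mulr1 -(pE2 y) -EZ; last exact: bm_sec2.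
by congr E; apply: funext => x /=; rewrite mulrC.
Qed.

(* Subtracting [delta] from the kernel does not change its action on functions of mean zero. *)
Lemma kop_contract b (M : R) : bm b -> (forall y, `|b y| <= M) -> E nu b = 0 ->
  forall x, `|kop nu p b x| <= M * (1 - delta).
Proof.
move=> bb bM b0 x.
have bd : bm (fun y => p (x, y) - delta) by apply: bmB; [exact: bm_sec1|exact: bm_cst].
have -> : kop nu p b x = E nu (fun y => (p (x, y) - delta) * b y).
  have -> : (fun y => (p (x, y) - delta) * b y) = (fun y => p (x, y) * b y - delta * b y).
    by apply: funext => y; rewrite mulrBl.
  by rewrite EB ?EZ ?b0 ?mulr0 ?subr0//; [exact: bm_kint|exact: bmZ].
have <- : E nu (fun y => M * (p (x, y) - delta)) = M * (1 - delta).
  by rewrite EZ// EB ?pE1 ?E_cst//; [exact: bm_sec1|exact: bm_cst].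
apply: E_norm_le; [exact: bmM|exact: bmZ|move=> y].
rewrite normrM (ger0_norm _) ?subr_ge0// mulrC ler_wpM2r// subr_ge0 //.
Qed.

End bist.
End markov.

Section swap.
Context {R : realType} d1 d2 (T1 : measurableType d1) (T2 : measurableType d2).

Lemma bist_swap (mu : probability T1 R) (nu : probability T2 R) (delta : R) p :
  bistochastic mu nu delta p -> bistochastic nu mu delta (swapk p).
Proof.
case=> bp pd p1 p2; split => //; first exact: bm_swap.
by move=> z; exact: pd.
Qed.

End swap.

(** * Inverting the linearized system by a Neumann series *)

Section linear_step.
Context {R : realType} d1 d2 (T1 : measurableType d1) (T2 : measurableType d2).
Variables (mu : probability T1 R) (nu : probability T2 R) (delta : R) (p : T1 * T2 -> R).
Hypothesis bp : bistochastic mu nu delta p.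
Hypothesis delta0 : 0 < delta.

Let d0 : 0 <= delta := ltW delta0.
Let bp' := bist_swap bp.
Let bmp : bm p. Proof. by case: bp. Qed.
Let bmp' : bm (swapk p). Proof. by case: bp'. Qed.

(** Terms of the series for the inverse of [1 + N], where [N] is the off-diagonal part
    [(a, b) |-> (P b, P' a)] and [P'] is the adjoint of [P]. *)
Definition neumann (f : T1 -> R) (g : T2 -> R) (k : nat) : (T1 -> R) * (T2 -> R) :=
  iter k (fun ab => ((fun x => - kop nu p ab.2 x), (fun y => - kop mu (swapk p) ab.1 y)))
    (f, g).

Lemma neumann_prop f g (M : R) k : bm f -> bm g -> E mu f = 0 -> E nu g = 0 ->
  (forall x, `|f x| <= M) -> (forall y, `|g y| <= M) ->
  let ab := neumann f g k in
  [/\ bm ab.1, bm ab.2, E mu ab.1 = 0, E nu ab.2 = 0 &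
   (forall x, `|ab.1 x| <= M * (1 - delta) ^+ k) /\
   (forall y, `|ab.2 y| <= M * (1 - delta) ^+ k)].
Proof.
move=> bf bg f0 g0 fM gM; elim: k => [|k]; first by rewrite /= expr0 mulr1.
rewrite /neumann iterS -/(neumann f g k); set ab := neumann f g k => /= -[b1 b2 e1 e2 [l1 l2]].
split.
- by apply: bmN; exact: (bm_kop mu).
- by apply: bmN; exact: (bm_kop nu).
- by rewrite EN ?(E_kop bp) ?e2 ?oppr0//; exact: (bm_kop mu).
- by rewrite EN ?(E_kop bp') ?e1 ?oppr0//; exact: (bm_kop nu).
split=> x; rewrite normrN exprSr mulrA.
  exact: (kop_contract bp).
exact: (kop_contract bp').
Qed.

(** Telescoping: [G n.+1] cancels the image of [F n], and only [G 0] survives. The spaces and the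
    kernel are generic so that both components of the system are instances. *)
Lemma kop_neumann d d' (U : measurableType d) (U' : measurableType d')
    (q : U * U' -> R) (rho : probability U' R) (F : nat -> U' -> R) (G : nat -> U -> R)
    (M : nat -> R) A : bm q ->
  (forall n, bm (F n)) -> (forall n y, `|F n y| <= M n) -> asum M A ->
  (forall n x, `|G n x| <= M n) ->
  (forall n x, G n.+1 x = - kop rho q (F n) x) ->
  forall x, limn (series (G^~ x)) + kop rho q (fun y => limn (series (F^~ y))) x = G 0%N x.
Proof.
move=> bq bF FM MA GM GS x.
have [_ [Q qQ]] := bq.
have Q0 : 0 <= Q by exact: le_trans (qQ point).
have cG : series (G^~ x) @ \oo --> limn (series (G^~ x)) by exact: asum_dom_cvg MA.
have cF : series (fun n => kop rho q (F n) x) @ \oo -->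
    kop rho q (fun y => limn (series (F^~ y))) x.
  have -> : kop rho q (fun y => limn (series (F^~ y))) x =
     E rho (fun y => limn (series (fun n => q (x, y) * F n y))).
    congr E; apply: funext => y; apply/esym/lim_eq.
    have -> : series (fun n => q (x, y) * F n y) = (fun N => q (x, y) * series (F^~ y) N).
      by apply: funext => N; rewrite !seriesEord /= mulr_sumr.
    apply: cvgM; first exact: cvg_cst.
    exact: (@asum_dom_cvg _ (F^~ y) M A).
  apply: (@E_series _ _ _ _ (fun n y => q (x, y) * F n y) (fun n => Q * M n) (Q * A)).
  - by move=> n; exact: bm_kint.
  - by move=> n y; rewrite normrM ler_pM.
  - exact: asumZ.
have e : (fun N => series (G^~ x) N.+1 + series (fun n => kop rho q (F n) x) N) @ \oo -->
   limn (series (G^~ x)) + kop rho q (fun y => limn (series (F^~ y))) x.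
  by apply: cvgD => //; rewrite (cvg_shiftS (series (G^~ x))).
rewrite -(lim_eq e); apply: lim_eq.
have -> : (fun N => series (G^~ x) N.+1 + series (fun n => kop rho q (F n) x) N) = fun=> G 0%N x.
  apply: funext => N; rewrite !seriesEord /= big_ord_recl /= -addrA.
  by rewrite -big_split /= big1 ?addr0// => i _; rewrite /bump /= add1n GS addNr.
exact: cvg_cst.
Qed.

(** Solvability needs the two right-hand sides to have equal means; the constant [t] repairs the
    first one. Centring [f] and [g] at most doubles their bound, and the Neumann series then has
    ratio [1 - delta], whence [2 M / delta]. *)
Lemma linear_step (f : T1 -> R) (g : T2 -> R) : bm f -> bm g ->
  exists abt : (T1 -> R) * (T2 -> R) * R, let: (a, b, t) := abt in
  [/\ bm a, bm b,
   forall x, a x + kop nu p b x = f x + t, forall y, b y + kop mu (swapk p) a y = g y &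
   forall M : R, (forall x, `|f x| <= M) -> (forall y, `|g y| <= M) ->
    (forall x, `|a x| <= (2 + 2 / delta) * M) /\ (forall y, `|b y| <= (2 + 2 / delta) * M)].
Proof.
move=> bf bg; have dle1 := bist_delta_le1 bp.
pose f0 x := f x - E mu f; pose g0 y := g y - E nu g.
have bf0 : bm f0 by apply: bmB => //; exact: bm_cst.
have bg0 : bm g0 by apply: bmB => //; exact: bm_cst.
have f00 : E mu f0 = 0 by rewrite EB ?E_cst ?subrr//; exact: bm_cst.
have g00 : E nu g0 = 0 by rewrite EB ?E_cst ?subrr//; exact: bm_cst.
pose F n := (neumann f0 g0 n).1; pose G n := (neumann f0 g0 n).2.
pose a' x := limn (series (F^~ x)); pose b' y := limn (series (G^~ y)).
have bnd (M : R) : (forall x, `|f x| <= M) -> (forall y, `|g y| <= M) ->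
    [/\ 0 <= M, `|E nu g| <= M, forall n x, `|F n x| <= 2 * M * (1 - delta) ^+ n,
    forall n y, `|G n y| <= 2 * M * (1 - delta) ^+ n &
    asum (fun n => 2 * M * (1 - delta) ^+ n) (2 * M / delta)].
  move=> fM gM; have M0 : 0 <= M by exact: le_trans (fM point).
  have fM0 x : `|f0 x| <= 2 * M.
    rewrite mulr2n mulrDl mul1r; apply: le_trans (ler_normB _ _) _.
    by apply: lerD => //; exact: E_norm.
  have gM0 y : `|g0 y| <= 2 * M.
    rewrite mulr2n mulrDl mul1r; apply: le_trans (ler_normB _ _) _.
    by apply: lerD => //; exact: E_norm.
  split => //; first exact: E_norm.
  - by move=> n; have [_ _ _ _ []] := neumann_prop n bf0 bg0 f00 g00 fM0 gM0.
  - by move=> n; have [_ _ _ _ []] := neumann_prop n bf0 bg0 f00 g00 fM0 gM0.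
  - rewrite -[X in _ / X](_ : 1 - (1 - delta) = delta); last by ring.
    apply: asum_geometric; first by rewrite mulr_ge0.
    by rewrite subr_ge0 dle1 /= ltrBlDr ltrDl.
have [M [fM gM]] : exists M, (forall x, `|f x| <= M) /\ (forall y, `|g y| <= M).
  have [_ [Mf fM]] := bf; have [_ [Mg gM]] := bg; exists (Num.max Mf Mg).
  by split=> x; rewrite le_max ?fM ?gM ?orbT.
have [M0 EgM FM GM sM] := bnd M fM gM.
have fM0 := FM 0%N; have gM0 := GM 0%N; rewrite expr0 mulr1 in fM0 gM0.
have bF n : bm (F n) by have [] := neumann_prop n bf0 bg0 f00 g00 fM0 gM0.
have bG n : bm (G n) by have [] := neumann_prop n bf0 bg0 f00 g00 fM0 gM0.
have ba' : bm a' by exact: (bm_lim bF FM sM).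
have bb' : bm b' by exact: (bm_lim bG GM sM).
have e1 x : a' x + kop nu p b' x = f0 x.
  exact: (kop_neumann (G := F) (F := G) bmp bG GM sM FM).
have e2 y : b' y + kop mu (swapk p) a' y = g0 y.
  exact: (kop_neumann (G := G) (F := F) bmp' bF FM sM GM).
(* The mean of [g] is put entirely into [a]: the adjoint kernel reproduces constants, so the second
   equation becomes exact and the first is off by [E nu g - E mu f]. *)
exists (fun x => E nu g + a' x, b', E nu g - E mu f); split => //.
- by apply: bmD => //; exact: bm_cst.
- by move=> x; rewrite -addrA e1 /f0; ring.
- move=> y; rewrite (kopD bp') ?(kop_cst bp')//; last exact: bm_cst.
  by rewrite addrCA e2 /g0; ring.
move=> {FM GM sM EgM}N fN gN; have [N0 EgN FN GN sN] := bnd N fN gN.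
have l1 x : `|a' x| <= 2 * N / delta by apply: (@asum_dom_lim _ _ _ _ _ sN) => n.
have l2 y : `|b' y| <= 2 * N / delta by apply: (@asum_dom_lim _ _ _ _ _ sN) => n.
(* One of the two summands [N] is slack; the rounder constant is visibly at least [2]. *)
have e : (2 + 2 / delta) * N = N + 2 * N / delta + N by ring.
split=> x; rewrite e.
  apply: le_trans (ler_normD _ _) _; apply: le_trans (lerD EgN (l1 x)) _.
  by rewrite lerDl.
by apply: le_trans (l2 x) _; rewrite addrAC lerDr addr_ge0.
Qed.

End linear_step.

(** * Power series solution of the perturbed system *)

Section causal.
Context {V : Type} (v0 : V) (Phi : (nat -> V) -> nat -> V).
Variables (Ok : (nat -> V) -> Prop) (Q : V -> Prop).

(** Entry [n] of the iterates is frozen after [n + 1] rounds, and the solution is their diagonal. It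
    need not be an iterate itself, hence the second conclusion: each initial segment comes from an
    [Ok] sequence. [Q] records that entries of index 0 vanish, without which a convolution at order
    [n] would still see its factors at order [n]. *)
Lemma causal_fixpoint : Ok (fun=> v0) -> (forall z, Ok z -> Ok (Phi z)) ->
  (forall z, Ok z -> Q (z 0%N)) ->
  (forall z z' n, Q (z 0%N) -> Q (z' 0%N) -> (forall i, (i < n)%N -> z i = z' i) ->
    Phi z n = Phi z' n) ->
  exists z, (forall n, z n = Phi z n) /\
    (forall n, exists2 z', Ok z' & forall i, (i <= n)%N -> z i = z' i).
Proof.
move=> Ok0 OkS OkQ caus; pose zz k := iter k Phi (fun=> v0).
have Okz k : Ok (zz k) by elim: k => //= k; exact: OkS.
have stab n : forall k k', (n < k)%N -> (n < k')%N -> zz k n = zz k' n.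
  elim/ltn_ind: n => n IH [|k] [|k'] // nk nk'; apply: caus; [exact: OkQ|exact: OkQ|].
  by move=> i iin; apply: IH => //; exact: leq_trans iin _.
exists (fun n => zz n.+1 n); split=> n.
  apply: caus; [exact: OkQ|exact: OkQ|] => i iin.
  exact: stab.
exists (zz n.+1) => // i iin; exact: stab.
Qed.

End causal.

Definition hat {R : realType} (a : nat -> R) n : R := one_seq n + a n.

Lemma bm_hat {R : realType} d (T : measurableType d) (b : nat -> T -> R) n :
  (forall n, bm (b n)) -> bm (fun y => hat (b^~ y) n).
Proof. by move=> bb; apply: bmD => //; exact: bm_cst. Qed.

Section hat_lemmas.
Context {R : realType}.
Implicit Types (a : nat -> R) (A : R).

Lemma asum_hat a A : asum a A -> asum (hat a) (1 + A).
Proof. by move=> aA; apply: asumD => //; exact: asum_one. Qed.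

Lemma le_hat a (A : nat -> R) n : (forall n, `|a n| <= A n) -> `|hat a n| <= hat A n.
Proof.
move=> aA; apply: le_trans (ler_normD _ _) _; apply: lerD => //.
by rewrite ger0_norm // /one_seq ler0n.
Qed.

Lemma ps_hat a A h : asum a A -> `|h| <= 1 -> ps (hat a) h = 1 + ps a h.
Proof. by move=> aA h1; rewrite (psD asum_one aA h1) ps_one. Qed.

End hat_lemmas.

(** * Nonlinear terms of the perturbed system *)

Section perturbation_terms.
Context {R : realType} d1 d2 (T1 : measurableType d1) (T2 : measurableType d2).
Variables (nu : probability T2 R) (p : T1 * T2 -> R) (kap : nat -> T1 * T2 -> R).

(** Row normalization gives [int p (1 + kap) (1 + b) = 1 + P b + w] with [w = int p kap (1 + b)].
    Expanding [(1 + a) (1 + P b + w) = 1 + t] and keeping the linear part [a + P b] on the left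
    leaves [t - a * P b - (1 + a) * w]; [pert_F] is this without [t]. *)
Definition pert_w (b : nat -> T2 -> R) n x :=
  E nu (fun y => p (x, y) * conv (kap^~ (x, y)) (hat (b^~ y)) n).
Definition pert_F (a : nat -> T1 -> R) (b : nat -> T2 -> R) n x :=
  - (conv (a^~ x) (fun m => kop nu p (b m) x) n + conv (hat (a^~ x)) ((pert_w b)^~ x) n).

Hypothesis kap0 : forall z, kap 0%N z = 0.

Lemma pert_w0 b x : pert_w b 0%N x = 0.
Proof.
rewrite /pert_w -[RHS](E_cst nu 0); congr E; apply: funext => y.
by rewrite conv0 kap0 mul0r mulr0.
Qed.

Lemma pert_w_causal b b' n x : (forall i, (i < n)%N -> b i = b' i) ->
  pert_w b n x = pert_w b' n x.
Proof.
move=> bb'; congr E; apply: funext => y; congr (_ * _); apply: conv_causal0l => //.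
by move=> i iin; rewrite /hat bb'.
Qed.

(** In [a * P b] both factors vanish at order 0. In [(1 + a) * w] the factor [w] does, and [w] at
    order [n] only meets [b] below order [n] because [kap] starts at order 1. *)
Lemma pert_F_causal a a' b b' n : a 0%N = (fun=> 0) -> a' 0%N = (fun=> 0) ->
  b 0%N = (fun=> 0) -> b' 0%N = (fun=> 0) ->
  (forall i, (i < n)%N -> a i = a' i) -> (forall i, (i < n)%N -> b i = b' i) ->
  pert_F a b n = pert_F a' b' n.
Proof.
move=> a0 a0' b0 b0' aa' bb'; apply: funext => x; congr (- (_ + _)).
  have k0 : kop nu p (fun=> 0) x = 0.
    rewrite /kop -[RHS](E_cst nu 0); congr E; apply: funext => y; by rewrite mulr0.
  apply: conv_causal; rewrite ?a0 ?b0 ?a0' ?b0'//.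
    by move=> i iin; rewrite aa'.
  by move=> i iin; rewrite bb'.
rewrite (@conv_causal0r _ (hat (a^~ x)) (hat (a'^~ x))) ?pert_w0//.
  apply: conv_eq => // i iin; apply: pert_w_causal => j ji; apply: bb'.
  exact: leq_trans ji iin.
by move=> i iin; rewrite /hat aa'.
Qed.

Variables (mu : probability T1 R) (delta : R) (k : nat -> R).
Hypothesis bp : bistochastic mu nu delta p.
Hypothesis delta0 : 0 <= delta.
Hypothesis bkap : forall n, bm (kap n).
Hypothesis kapk : forall n z, `|kap n z| <= k n.

Let bmp : bm p. Proof. by case: bp. Qed.

Lemma bm_conv2 (K : nat -> T1 * T2 -> R) (b : nat -> T2 -> R) n :
  (forall n, bm (K n)) -> (forall n, bm (b n)) ->
  bm (fun z : T1 * T2 => conv (K^~ z) (b^~ z.2) n).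
Proof.
by move=> bK bb; apply: bm_sum => i; apply: bmM => //; exact: bm_snd.
Qed.

Lemma bm_pert_w b n : (forall n, bm (b n)) -> bm (pert_w b n).
Proof.
move=> bb; apply: (@bm_E2 R _ _ _ _ mu nu
  (fun z => p z * conv (kap^~ z) (hat (b^~ z.2)) n)).
apply: bmM => //; apply: (@bm_conv2 _ (fun n y => hat (b^~ y) n)) => // m.
exact: bm_hat.
Qed.

Lemma pert_w_le b (B : nat -> R) n : (forall n, bm (b n)) -> (forall n y, `|b n y| <= B n) ->
  forall x, `|pert_w b n x| <= conv k (hat B) n.
Proof.
move=> bb bB x.
have bq : bm (fun y => conv (kap^~ (x, y)) (hat (b^~ y)) n).
  apply: (@bm_sec1 R _ _ T1 T2 (fun z => conv (kap^~ z) (hat (b^~ z.2)) n) x).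
  apply: (@bm_conv2 _ (fun n y => hat (b^~ y) n)) => // m; exact: bm_hat.
have [_ pd p1 _] := bp; have p0 z : 0 <= p z by exact: le_trans (pd z).
rewrite -[leRHS]mulr1 -(p1 x) -EZ; last exact: bm_sec1.
apply: E_norm_le; [apply: bmM => //; exact: bm_sec1|apply: bmZ; exact: bm_sec1|move=> y].
rewrite normrM (ger0_norm (p0 _)) mulrC ler_wpM2r//.
by apply: le_conv => // m; apply: le_hat.
Qed.

Lemma bm_pert_F a b n : (forall n, bm (a n)) -> (forall n, bm (b n)) -> bm (pert_F a b n).
Proof.
move=> ba bb; apply: bmN; apply: bmD; apply: bm_sum => i; apply: bmM => //.
- exact: (bm_kop mu).
- exact: bm_hat.
- exact: bm_pert_w.
Qed.

(** Averaging against [p], whose rows have mass one, does not increase sup bounds, so the same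
    expression in the majorants dominates. *)
Lemma pert_F_le a b (A : nat -> R) n : (forall n, bm (a n)) -> (forall n, bm (b n)) ->
  (forall n x, `|a n x| <= A n) -> (forall n y, `|b n y| <= A n) ->
  forall x, `|pert_F a b n x| <= conv A A n + conv (hat A) (conv k (hat A)) n.
Proof.
move=> ba bb aA bA x; rewrite normrN; apply: le_trans (ler_normD _ _) _; apply: lerD.
  by apply: le_conv => // m; exact: (kop_le bp).
apply: le_conv => m; first exact: le_hat.
exact: pert_w_le.
Qed.

(* Coefficientwise form of [(1 + a) * int p (1 + kap) (1 + b) = 1 + t]. *)
Lemma pert_F_sum a b (A : nat -> R) (t : nat -> R) AA KK h : (forall n, bm (a n)) ->
  (forall n, bm (b n)) -> (forall n x, `|a n x| <= A n) -> (forall n y, `|b n y| <= A n) ->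
  asum A AA -> asum k KK -> `|h| < 1 ->
  (forall n x, a n x + kop nu p (b n) x = pert_F a b n x + t n) ->
  forall x, (1 + ps (a^~ x) h) *
     E nu (fun y => p (x, y) * (1 + ps (kap^~ (x, y)) h) * (1 + ps (b^~ y) h)) =
     ps (hat t) h.
Proof.
move=> ba bb aA bA sA sk h1 eqn x; have h1' := ltW h1.
pose khat z := hat (kap^~ z).
pose v n x := E nu (fun y => p (x, y) * conv (khat (x, y)) (hat (b^~ y)) n).
have sa x' : asum (a^~ x') AA.
  by apply: le_asum sA => n; apply: le_trans (aA n x') _; exact: ler_norm.
have sb y : asum (b^~ y) AA.
  by apply: le_asum sA => n; apply: le_trans (bA n y) _; exact: ler_norm.
have skp z : asum (kap^~ z) KK.
  by apply: le_asum sk => n; apply: le_trans (kapk n z) _; exact: ler_norm.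
have [_ pd p1 _] := bp; have p0 z : 0 <= p z by exact: le_trans (pd z).
have bc n : bm (fun z => conv (khat z) (hat (b^~ z.2)) n).
  apply: (@bm_conv2 (fun n z => khat z n) (fun n y => hat (b^~ y) n)) => m.
    exact: bm_hat.
  exact: bm_hat.
have ck n z : `|conv (khat z) (hat (b^~ z.2)) n| <= conv (hat k) (hat A) n.
  by apply: le_conv => m; exact: le_hat.
have bint n x' : bm (fun y => p (x', y) * conv (khat (x', y)) (hat (b^~ y)) n).
  by apply: bmM; [exact: bm_sec1|exact: (@bm_sec1 R _ _ T1 T2 _ x' (bc n))].
have sv x' : asum (v^~ x') ((1 + KK) * (1 + AA)).
  apply: le_asum (asum_conv (asum_hat sk) (asum_hat sA)) => n.
  apply: le_trans (ler_norm _).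
  rewrite -[leRHS]mulr1 -(p1 x') -EZ; last exact: bm_sec1.
  apply: E_norm_le => //; first by apply: bmZ; exact: bm_sec1.
  move=> y; rewrite normrM (ger0_norm (p0 _)) mulrC ler_wpM2r//.
have vE n x' : v n x' = one_seq n + kop nu p (b n) x' + pert_w b n x'.
  have -> : one_seq n + kop nu p (b n) x' = kop nu p (fun y => one_seq n + b n y) x'.
    by rewrite (kopD bp) ?(kop_cst bp)//; exact: bm_cst.
  rewrite /kop /pert_w -ED.
  - congr E; apply: funext => y; rewrite -mulrDr; congr (_ * _).
    by rewrite /khat /hat convDl conv1l.
  - by apply: bm_kint => //; apply: bmD => //; exact: bm_cst.
  - apply: bmM; first exact: bm_sec1.
    apply: (@bm_sec1 R _ _ T1 T2 (fun z => conv (kap^~ z) (hat (b^~ z.2)) n) x').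
    by apply: (@bm_conv2 _ (fun n y => hat (b^~ y) n)) => // m; exact: bm_hat.
have cE n : conv (hat (a^~ x)) (v^~ x) n = hat t n.
  have -> : v^~ x = fun m => hat (fun m => kop nu p (b m) x) m + pert_w b m x.
    by apply: funext => m; rewrite vE.
  rewrite convDr {1}/hat convDl conv1l {2}/hat convDr conv1r.
  have := eqn n x; rewrite /pert_F /hat; lra.
rewrite -(ps_hat (sa x) h1') -[RHS](_ : ps (conv (hat (a^~ x)) (v^~ x)) h = _); last first.
  by congr ps; apply: funext => n; exact: cE.
rewrite (ps_conv (asum_hat (sa x)) (sv x) h1); congr (_ * _).
have [_ [P pP]] := bmp; have P0 : 0 <= P by exact: le_trans (pP point).
rewrite -(@E_ps _ _ _ nu (fun n y => p (x, y) * conv (khat (x, y)) (hat (b^~ y)) n)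
  (fun n => P * conv (hat k) (hat A) n) (P * ((1 + KK) * (1 + AA))) h) //; last 2 first.
- by move=> n y; rewrite normrM ler_pM//; exact: (ck n (x, y)).
- by apply: asumZ => //; apply: asum_conv; exact: asum_hat.
congr E; apply: funext => y.
rewrite (psZ _ (asum_conv (asum_hat (skp (x, y))) (asum_hat (sb y))) h1').
rewrite (ps_conv (asum_hat (skp (x, y))) (asum_hat (sb y)) h1).
by rewrite (ps_hat (skp (x, y)) h1') (ps_hat (sb y) h1') mulrA.
Qed.

End perturbation_terms.

(** * Solving the perturbed system together with its majorant *)

Section perturbation.
Context {R : realType} d1 d2 (T1 : measurableType d1) (T2 : measurableType d2).
Variables (mu : probability T1 R) (nu : probability T2 R) (delta : R) (p : T1 * T2 -> R).
Hypothesis bp : bistochastic mu nu delta p.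
Hypothesis delta0 : 0 < delta.
Variables (kap : nat -> T1 * T2 -> R) (k : nat -> R).
Hypothesis bkap : forall n, bm (kap n).
Hypothesis kapk : forall n z, `|kap n z| <= k n.
Hypothesis k0 : k 0%N = 0.

Let C := 2 + 2 / delta.
Hypothesis sk : asum k (16 * C ^+ 2)^-1.

Let bp' := bist_swap bp.
Let C0 : 0 < C. Proof. by rewrite addr_gt0// divr_gt0. Qed.
Let C2 : 2 <= C. Proof. by rewrite lerDl divr_ge0// ltW. Qed.
Let kap' n := swapk (kap n).
Let kap00 z : kap 0%N z = 0.
Proof. by have := kapk 0 z; rewrite k0 normr_le0 => /eqP. Qed.
Let kap'00 z : kap' 0%N z = 0. Proof. exact: kap00. Qed.
Let bkap' n : bm (kap' n). Proof. exact: bm_swap. Qed.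
Let kapk' n z : `|kap' n z| <= k n. Proof. exact: kapk. Qed.
Let d0 := ltW delta0.

(** Each order carries the two coefficient functions and a scalar bound for both, so that one causal
    iteration yields the solution and its majorant. *)
Let V : Type := ((T1 -> R) * (T2 -> R) * R)%type.
Let va (z : nat -> V) n := (z n).1.1.
Let vb (z : nat -> V) n := (z n).1.2.
Let vA (z : nat -> V) n := (z n).2.
Let F1 (z : nat -> V) := pert_F nu p kap (va z) (vb z).
Let F2 (z : nat -> V) := pert_F mu (swapk p) kap' (vb z) (va z).
Let Fb (z : nat -> V) n := C * (conv (vA z) (vA z) n + conv (hat (vA z)) (conv k (hat (vA z))) n).

Let Ok (z : nat -> V) := [/\ forall n, bm (va z n), forall n, bm (vb z n),
  forall n x, `|va z n x| <= vA z n, forall n y, `|vb z n y| <= vA z n &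
  vA z 0%N = 0 /\ asum (vA z) (2 * C)^-1].

(** The majorant iteration preserves total mass [B = 1 / (2 C)]. With [k] of mass
    [1 / (16 C^2) = B^2 / 4] the new mass is [B / 2 + (B / 8) (1 + B)^2], and [B <= 1] bounds the
    last term by [B / 2]. *)
Let Bbound : C * ((2 * C)^-1 * (2 * C)^-1 + (1 + (2 * C)^-1) * ((16 * C ^+ 2)^-1 * (1 + (2 * C)^-1)))
   <= (2 * C)^-1.
Proof.
set B := (2 * C)^-1; have C0' : C != 0 by rewrite gt_eqF.
have e1 : C * (B * B) = B / 2 by rewrite /B; field.
have e2 : (16 * C ^+ 2)^-1 = B ^+ 2 / 4 by rewrite /B; field.
have e3 : C * B = 2^-1 by rewrite /B; field.
have B0 : 0 <= B by rewrite invr_ge0 mulr_ge0// ltW.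
have B1 : B <= 1.
  rewrite invf_le1; last by rewrite mulr_gt0.
  by apply: le_trans (_ : 2 * 2 <= _); [lra|rewrite ler_pM2l].
have -> : C * (B * B + (1 + B) * ((16 * C ^+ 2)^-1 * (1 + B))) =
   B / 2 + B / 8 * (1 + B) ^+ 2.
  by rewrite mulrDr e1 e2; congr +%R; transitivity (C * B * (B / 4 * (1 + B) ^+ 2)); [ring|rewrite e3; field].
have : (1 + B) ^+ 2 <= 4 by nra.
nra.
Qed.

Let sol_spec (fg : (T1 -> R) * (T2 -> R)) (s : (T1 -> R) * (T2 -> R) * R) :=
  bm fg.1 -> bm fg.2 -> let: (a, b, t) := s in
  [/\ bm a, bm b,
   forall x, a x + kop nu p b x = fg.1 x + t, forall y, b y + kop mu (swapk p) a y = fg.2 y &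
   forall M : R, (forall x, `|fg.1 x| <= M) -> (forall y, `|fg.2 y| <= M) ->
    (forall x, `|a x| <= C * M) /\ (forall y, `|b y| <= C * M)].

(** The linear solver has to be an actual function: causality of the iteration requires equal
    right-hand sides to get equal solutions. Off bounded data its value is arbitrary. *)
Let sol_exists : exists Sol, forall fg, sol_spec fg (Sol fg).
Proof.
suff h fg : exists s, sol_spec fg s.
  by exists (fun fg => projT1 (cid (h fg))) => fg; exact: projT2 (cid (h fg)).
have [[b1 b2]|nb] := pselect (bm fg.1 /\ bm fg.2).
  by have [s hs] := linear_step bp delta0 b1 b2; exists s.
by exists (fun=> 0, fun=> 0, 0) => b1 b2; case: nb.
Qed.

Lemma perturbation_coef : exists (a : nat -> T1 -> R) (b : nat -> T2 -> R) (A t : nat -> R),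
  [/\ forall n, bm (a n), forall n, bm (b n),
      forall n x, `|a n x| <= A n, forall n y, `|b n y| <= A n &
  [/\ A 0%N = 0, asum A (2 * C)^-1,
      forall n x, a n x + kop nu p (b n) x = pert_F nu p kap a b n x + t n &
      forall n y, b n y + kop mu (swapk p) (a n) y = pert_F mu (swapk p) kap' b a n y]].
Proof.
have [Sol SolP] := sol_exists.
(* The third component returned by [Sol] is the constant [t], not a bound. It is replaced here by
   the majorant and read off again once the fixed point is known. *)
pose Phi (z : nat -> V) n : V := ((Sol (F1 z n, F2 z n)).1, Fb z n).
have bF1 z n : Ok z -> bm (F1 z n).
  by case=> ba bb _ _ _; exact: (bm_pert_F bp).
have bF2 z n : Ok z -> bm (F2 z n).
  by case=> ba bb _ _ _; exact: (bm_pert_F bp').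
have OkF z n : Ok z -> (forall x, `|F1 z n x| <= Fb z n / C) /\ (forall x, `|F2 z n x| <= Fb z n / C).
  case=> ba bb aA bA _; rewrite /Fb mulrC mulKf ?gt_eqF//; split=> x.
    exact: (pert_F_le bp d0).
  exact: (pert_F_le bp' d0).
have Fb0 z : vA z 0%N = 0 -> Fb z 0%N = 0.
  by move=> A0; rewrite /Fb !conv0 A0 k0 !(mulr0, mul0r, addr0).
have OkS z : Ok z -> Ok (Phi z).
  move=> Okz; split.
  - move=> n; rewrite /va /Phi /=.
    have := SolP (F1 z n, F2 z n) (bF1 z n Okz) (bF2 z n Okz).
    by case: (Sol _) => -[a b] t [].
  - move=> n; rewrite /vb /Phi /=.
    have := SolP (F1 z n, F2 z n) (bF1 z n Okz) (bF2 z n Okz).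
    by case: (Sol _) => -[a b] t [].
  - move=> n; rewrite /va /vA /Phi /=.
    have := SolP (F1 z n, F2 z n) (bF1 z n Okz) (bF2 z n Okz).
    case: (Sol _) => -[a b] t [_ _ _ _ h] x; have [l1 l2] := OkF z n Okz.
    by have [+ _] := h _ l1 l2 => /(_ x); rewrite mulrCA mulfV ?mulr1// gt_eqF.
  - move=> n; rewrite /vb /vA /Phi /=.
    have := SolP (F1 z n, F2 z n) (bF1 z n Okz) (bF2 z n Okz).
    case: (Sol _) => -[a b] t [_ _ _ _ h] x; have [l1 l2] := OkF z n Okz.
    by have [_ +] := h _ l1 l2 => /(_ x); rewrite mulrCA mulfV ?mulr1// gt_eqF.
  - case: Okz => _ _ _ _ [A0 sA]; split; first exact: Fb0.
    move=> N; apply: le_trans Bbound; move: N.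
    apply: (@asumZ _ (fun n => conv (vA z) (vA z) n + conv (hat (vA z)) (conv k (hat (vA z))) n)).
      exact: ltW.
    apply: asumD; first exact: asum_conv.
    apply: asum_conv; first exact: asum_hat.
    by apply: asum_conv => //; exact: asum_hat.
pose Q (v : V) := [/\ v.1.1 = (fun=> 0), v.1.2 = (fun=> 0) & v.2 = 0].
have OkQ z : Ok z -> Q (z 0%N).
  case=> _ _ aA bA [A0 _]; split => //.
    by apply: funext => x; have := aA 0%N x; rewrite A0 normr_le0 => /eqP.
  by apply: funext => x; have := bA 0%N x; rewrite A0 normr_le0 => /eqP.
have Ok0 : Ok (fun=> ((fun=> 0), (fun=> 0), 0)).
  split; rewrite /va /vb /vA /=; try by move=> *; rewrite ?normr0//; exact: bm_cst.
  split=> // N; rewrite big1 ?invr_ge0 ?mulr_ge0 ?(ltW C0)// => i _; by rewrite normr0.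
have caus z z' n : Q (z 0%N) -> Q (z' 0%N) -> (forall i, (i < n)%N -> z i = z' i) ->
    Phi z n = Phi z' n.
  move=> [a0 b0 A0] [a0' b0' A0'] zz'; rewrite /Phi.
  have -> : F1 z n = F1 z' n.
    by apply: pert_F_causal => // i iin; rewrite /va /vb zz'.
  have -> : F2 z n = F2 z' n.
    by apply: pert_F_causal => // i iin; rewrite /va /vb zz'.
  congr (_, _); rewrite /Fb; congr (_ * (_ + _)).
    by apply: conv_causal => // i iin; rewrite /vA zz'.
  have k00 u : conv k u 0%N = 0 by rewrite conv0 k0 mul0r.
  rewrite (@conv_causal0r _ (hat (vA z)) (hat (vA z')))//.
    apply: conv_eq => // i iin; apply: conv_causal0l => // j ji.
    by rewrite /hat /vA zz'// (leq_trans ji).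
  by move=> i iin; rewrite /hat /vA zz'.
have [z [zE zOk]] := causal_fixpoint Ok0 OkS OkQ caus.
have Okz : Ok z.
  split=> [n|n|n|n|].
  - by have [z' [h _ _ _ _] /(_ n (leqnn n)) e] := zOk n; rewrite /va e; exact: h.
  - by have [z' [_ h _ _ _] /(_ n (leqnn n)) e] := zOk n; rewrite /vb e; exact: h.
  - by have [z' [_ _ h _ _] /(_ n (leqnn n)) e] := zOk n; rewrite /va /vA e; exact: h.
  - by have [z' [_ _ _ h _] /(_ n (leqnn n)) e] := zOk n; rewrite /vb /vA e; exact: h.
  - split; first by have [z' [_ _ _ _ [h _]] /(_ 0%N (leqnn 0)) e] := zOk 0%N; rewrite /vA e.
    move=> N; have [z' [_ _ _ _ [_ h]] e] := zOk N; apply: le_trans (h N).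
    by apply: ler_sum => i _; rewrite /vA e// ltnW.
have SP n := SolP (F1 z n, F2 z n) (bF1 z n Okz) (bF2 z n Okz).
exists (va z), (vb z), (vA z), (fun n => (Sol (F1 z n, F2 z n)).2).
case: (Okz) => ba bb aA bA [A0 sA]; split => //; split => //.
- move=> n x; rewrite -/(F1 z n) /va /vb zE /Phi /=; have := SP n.
  by case: (Sol _) => -[a b] t [].
- move=> n x; rewrite -/(F2 z n) /va /vb zE /Phi /=; have := SP n.
  by case: (Sol _) => -[a b] t [].
Qed.

(* The constants [t] left by the linear steps sum to zero: integrate both equations. *)
Lemma perturbation : exists (a : nat -> T1 -> R) (b : nat -> T2 -> R) (A : nat -> R),
  [/\ forall n, bm (a n), forall n, bm (b n),
      forall n x, `|a n x| <= A n, forall n y, `|b n y| <= A n &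
  asum A 2^-1 /\ forall h, `|h| < 1 ->
   (forall x, (1 + ps (a^~ x) h) *
     E nu (fun y => p (x, y) * (1 + ps (kap^~ (x, y)) h) * (1 + ps (b^~ y) h)) = 1) /\
   (forall y, (1 + ps (b^~ y) h) *
     E mu (fun x => p (x, y) * (1 + ps (kap^~ (x, y)) h) * (1 + ps (a^~ x) h)) = 1)].
Proof.
have [a [b [A [t [ba bb aA bA [A0 sA eq1 eq2]]]]]] := perturbation_coef.
have sA2 : asum A 2^-1.
  move=> N; apply: le_trans (sA N) _; rewrite lef_pV2 ?posrE ?mulr_gt0//.
  by rewrite ler_peMr// (le_trans _ C2)//; lra.
exists a, b, A; split => //; split => // h h1; have h1' := ltW h1.
have t00 n y : b n y + kop mu (swapk p) (a n) y = pert_F mu (swapk p) kap' b a n y + (fun=> 0) n.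
  by rewrite eq2 addr0.
have e2 := pert_F_sum bp' d0 bkap' kapk' bb ba bA aA sA sk h1 t00.
have e1 := pert_F_sum bp d0 bkap kapk ba bb aA bA sA sk h1 eq1.
have h0 : ps (hat (fun=> 0)) h = 1.
  by rewrite -(ps_one h); congr ps; apply: funext => n; rewrite /hat addr0.
rewrite h0 in e2; set tau := ps (hat t) h in e1.
suff tau1 : tau = 1 by rewrite tau1 in e1; split.
pose G (z : T1 * T2) := (1 + ps (a^~ z.1) h) * (p z * (1 + ps (kap^~ z) h) * (1 + ps (b^~ z.2) h)).
have bpa : bm (fun x => 1 + ps (a^~ x) h).
  by apply: bmD; [exact: bm_cst|exact: (bm_ps ba aA sA)].
have bpb : bm (fun y => 1 + ps (b^~ y) h).
  by apply: bmD; [exact: bm_cst|exact: (bm_ps bb bA sA)].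
have bpk : bm (fun z => p z * (1 + ps (kap^~ z) h)).
  apply: bmM; first by case: bp.
  by apply: bmD; [exact: bm_cst|exact: (bm_ps bkap kapk sk)].
have bG : bm G.
  exact: (bmM (@bm_fst R _ _ T1 T2 _ bpa) (bmM bpk (@bm_snd R _ _ T1 T2 _ bpb))).
rewrite -(E_cst mu tau) -[RHS](E_cst nu 1).
transitivity (E mu (fun x => E nu (fun y => G (x, y)))).
  congr E; apply: funext => x; rewrite -(e1 x) -EZ//.
  by apply: bmM => //; exact: (@bm_sec1 R _ _ T1 T2 _ x bpk).
rewrite (fubini12 mu nu bG) -(fubini21 mu nu bG); congr E; apply: funext => y.
rewrite -(e2 y) -EZ; last by apply: bmM => //; exact: (@bm_sec2 R _ _ T1 T2 _ y bpk).
by congr E; apply: funext => x; rewrite /G /swapk /kap' /=; ring.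
Qed.


End perturbation.

(** * The Schroedinger system *)

Section schrodinger.
Context {R : realType} d1 d2 (T1 : measurableType d1) (T2 : measurableType d2).
Variables (mu : probability T1 R) (nu : probability T2 R).
Implicit Types (K : T1 * T2 -> R) (a : T1 -> R) (b : T2 -> R) (m M : R).

Definition pos_bm d (T : measurableType d) (f : T -> R) :=
  bm f /\ exists2 m : R, 0 < m & forall x, m <= f x.

Definition schrodinger K a b := [/\ pos_bm a, pos_bm b,
  forall x, a x * E nu (fun y => K (x, y) * b y) = 1 &
  forall y, b y * E mu (fun x => K (x, y) * a x) = 1].

Definition gibbs K a b (z : T1 * T2) := a z.1 * K z * b z.2.

Lemma bm_gibbs K a b : bm K -> bm a -> bm b -> bm (gibbs K a b).
Proof.
move=> bK ba bb.
exact: (bmM (bmM (@bm_fst R _ _ T1 T2 _ ba) bK) (@bm_snd R _ _ T1 T2 _ bb)).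
Qed.

(** With [A] and [B] the integrals of [a] and [b], the equations give [a >= 1 / (M B)] and
    [b >= 1 / (M A)], while integrating [a * m * B <= 1] gives [A B <= 1 / m]. Hence
    [a K b >= m / (M^2 A B) >= (m / M)^2], a bound blind to the scaling [(l a, b / l)]. *)
Lemma gibbs_bistochastic K a b m M : bm K -> 0 < m -> (forall z, m <= K z <= M) ->
  schrodinger K a b -> bistochastic mu nu ((m / M) ^+ 2) (gibbs K a b).
Proof.
move=> bK m0 mKM [[ba [ma ma0 am]] [bb [mb mb0 bmb]] e1 e2].
have M0 : 0 < M.
  by have /andP[u v] := mKM point; apply: lt_le_trans m0 (le_trans u v).
have bKs x : bm (fun y => K (x, y)) by exact: bm_sec1.
have bKs' y : bm (fun x => K (x, y)) by exact: bm_sec2.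
pose A := E mu a; pose B := E nu b.
have A0 : 0 < A.
  by apply: lt_le_trans ma0 _; rewrite -(E_cst mu ma); apply: le_E => //; exact: bm_cst.
have B0 : 0 < B.
  by apply: lt_le_trans mb0 _; rewrite -(E_cst nu mb); apply: le_E => //; exact: bm_cst.
have a0 x : 0 < a x by exact: lt_le_trans (am x).
have b0 y : 0 < b y by exact: lt_le_trans (bmb y).
have a1 x : 1 <= a x * (M * B).
  rewrite -(e1 x) ler_pM2l// -EZ//; apply: le_E => //; [exact: bmM|exact: bmZ|].
  by move=> y; rewrite ler_pM2r//; have /andP[] := mKM (x, y).
have b1 y : 1 <= b y * (M * A).
  rewrite -(e2 y) ler_pM2l// -EZ//; apply: le_E => //; [exact: bmM|exact: bmZ|].
  by move=> x; rewrite ler_pM2r//; have /andP[] := mKM (x, y).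
have a2 x : a x * (m * B) <= 1.
  rewrite -(e1 x) ler_pM2l// -EZ//; apply: le_E => //; [exact: bmZ|exact: bmM|].
  by move=> y; rewrite ler_pM2r//; have /andP[] := mKM (x, y).
have AB : A * (m * B) <= 1.
  rewrite mulrC -EZ// -(E_cst mu 1); apply: le_E => //; [exact: bmZ|exact: bm_cst|].
  by move=> x; rewrite mulrC.
split; first exact: bm_gibbs.
- move=> [x y]; rewrite /gibbs /=; have /andP[mK _] := mKM (x, y).
  apply: (@le_trans _ _ (m * (a x * b y))); last first.
    by rewrite [leRHS]mulrAC mulrC ler_pM2l// mulr_gt0.
  rewrite expr_div_n expr2 -mulrA ler_pM2l// ler_pdivrMr ?exprn_gt0//.
  have h : 1 <= (a x * (M * B)) * (b y * (M * A)).
    by rewrite -[X in X <= _]mul1r ler_pM.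
  have h2 : 0 <= a x * b y * M ^+ 2 by rewrite !mulr_ge0 ?exprn_ge0 ?ltW.
  have h3 : m * ((a x * (M * B)) * (b y * (M * A))) <= a x * b y * M ^+ 2.
    have -> : m * ((a x * (M * B)) * (b y * (M * A))) = a x * b y * M ^+ 2 * (A * (m * B)) by ring.
    by rewrite ler_piMr.
  by apply: le_trans h3; rewrite ler_peMr// ltW.
- move=> x; rewrite -(e1 x) -EZ; last exact: bmM.
  by congr E; apply: funext => y; rewrite /gibbs /= mulrA.
- move=> y; rewrite -(e2 y) -EZ; last exact: bmM.
  by congr E; apply: funext => x; rewrite /gibbs /=; ring.
Qed.

(** The threshold [1 / (16 C^2)] of the perturbation step at [delta = (m / M)^2]. *)
Definition radius m M : R := (16 * (2 + 2 / (m / M) ^+ 2) ^+ 2)^-1.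

Lemma radius_gt0 m M : 0 < m -> 0 < M -> 0 < radius m M.
Proof.
move=> m0 M0; rewrite invr_gt0 mulr_gt0// exprn_gt0// addr_gt0// divr_gt0//.
by rewrite exprn_gt0// divr_gt0.
Qed.

(** For multiplicative perturbations of [K], [a] and [b], the base factors gather into the
    bistochastic density [a K b], which reduces the claim to the perturbed bistochastic system.
    Corrections of size at most [1/2] keep the new potentials bounded below. *)
Lemma schrodinger_perturb K a b m M (kap : nat -> T1 * T2 -> R) (k : nat -> R) :
  bm K -> 0 < m -> (forall z, m <= K z <= M) -> schrodinger K a b ->
  (forall n, bm (kap n)) -> (forall n z, `|kap n z| <= k n) -> k 0%N = 0 ->
  asum k (radius m M) ->
  exists (al : nat -> T1 -> R) (be : nat -> T2 -> R) (A : nat -> R),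
  [/\ forall n, bm (al n), forall n, bm (be n),
      forall n x, `|al n x| <= A n, forall n y, `|be n y| <= A n &
  asum A 2^-1 /\ forall h, `|h| < 1 ->
     schrodinger (fun z => K z * (1 + ps (kap^~ z) h))
       (fun x => a x * (1 + ps (al^~ x) h)) (fun y => b y * (1 + ps (be^~ y) h))].
Proof.
move=> bK m0 mKM sch bkap kapk k0 sk.
have M0 : 0 < M.
  by have /andP[u v] := mKM point; apply: lt_le_trans m0 (le_trans u v).
have bist := gibbs_bistochastic bK m0 mKM sch.
have d0 : 0 < (m / M) ^+ 2 by rewrite exprn_gt0// divr_gt0.
have [al [be [A [bal bbe alA beA [sA sol]]]]] := perturbation bist d0 bkap kapk k0 sk.
exists al, be, A; split => //; split => // h h1; have h1' := ltW h1.
case: sch => -[ba [ma ma0 am]] [bb [mb mb0 bmb]] _ _.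
have [sol1 sol2] := sol _ h1.
have half (u : nat -> R) : (forall n, `|u n| <= A n) -> 2^-1 <= 1 + ps u h.
  move=> uA; have su : asum u 2^-1.
    by apply: le_asum sA => n; apply: le_trans (uA n) _; exact: ler_norm.
  by have := ps_le su h1'; rewrite ler_norml => /andP[]; lra.
have bpa : bm (fun x => 1 + ps (al^~ x) h).
  by apply: bmD; [exact: bm_cst|exact: (bm_ps bal alA sA)].
have bpb : bm (fun y => 1 + ps (be^~ y) h).
  by apply: bmD; [exact: bm_cst|exact: (bm_ps bbe beA sA)].
have bpk : bm (fun z => 1 + ps (kap^~ z) h).
  by apply: bmD; [exact: bm_cst|exact: (bm_ps bkap kapk sk)].
split.
- split; first exact: bmM.
  exists (ma * 2^-1); first by rewrite mulr_gt0.
  by move=> x; apply: ler_pM => //; [exact: ltW|apply: (half (al^~ x)) => n].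
- split; first exact: bmM.
  exists (mb * 2^-1); first by rewrite mulr_gt0.
  by move=> x; apply: ler_pM => //; [exact: ltW|apply: (half (be^~ x)) => n].
- move=> x; rewrite -[RHS](sol1 x) -mulrA mulrCA; congr (_ * _).
  rewrite -EZ; last first.
    apply: bmM; last exact: bmM.
    by apply: bmM; [exact: bm_sec1|exact: (@bm_sec1 R _ _ T1 T2 _ x bpk)].
  by congr E; apply: funext => y; rewrite /gibbs /=; ring.
- move=> y; rewrite -[RHS](sol2 y) -mulrA mulrCA; congr (_ * _).
  rewrite -EZ; last first.
    apply: bmM; last exact: bmM.
    by apply: bmM; [exact: bm_sec2|exact: (@bm_sec2 R _ _ T1 T2 _ y bpk)].
  by congr E; apply: funext => x; rewrite /gibbs /=; ring.
Qed.

Lemma ps_single (c h : R) : ps (fun n => if n == 1%N then c else 0) h = c * h.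
Proof.
apply: lim_eq; rewrite -(cvg_shiftn 2) /=.
have -> : (fun n => series (fun n => (if n == 1%N then c else 0) * h ^+ n) (n + 2)%N) = (fun=> c * h).
  apply: funext => n; rewrite seriesEord /= addn2 !big_ord_recl /= mul0r add0r big1 ?addr0//.
  by move=> i _; rewrite mul0r.
exact: cvg_cst.
Qed.

(* Continuation along the segment from the kernel [1] to [K]; the step length is uniform. *)
Lemma schrodinger_exists K m M : bm K -> 0 < m -> (forall z, m <= K z <= M) ->
  exists a b, schrodinger K a b.
Proof.
(* Once [1] lies between the bounds, so does every kernel on the segment from [1] to [K]. *)
wlog [m1 M1] : m M / m <= 1 /\ 1 <= M.
  move=> H bK m0 mKM; apply: (H (Num.min m 1) (Num.max M 1)) => //.
  - by rewrite ge_min lexx orbT le_max lexx orbT.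
  - by rewrite lt_min m0 ltr01.
  - by move=> z; have /andP[u v] := mKM z; rewrite ge_min u le_max v.
move=> bK m0 mKM; have M0 : 0 < M by exact: lt_le_trans ltr01 M1.
pose L := (M + 1) / m; have L0 : 0 < L by rewrite divr_gt0// addr_gt0.
pose r := radius m M / L; have r0 : 0 < r by rewrite divr_gt0// radius_gt0.
pose Kt t z := 1 + t * (K z - 1).
have bKt t : bm (Kt t).
  by apply: bmD; [exact: bm_cst|apply: bmZ; apply: bmB => //; exact: bm_cst].
have Ktb (t : R) z : 0 <= t <= 1 -> m <= Kt t z <= M.
  move=> /andP[t0 t1]; have /andP[u v] := mKM z; rewrite /Kt; apply/andP; split; nra.
have step (t s : R) : 0 <= t <= 1 -> 0 <= s <= r / 2 -> (exists a b, schrodinger (Kt t) a b) ->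
    exists a b, schrodinger (Kt (t + s)) a b.
  move=> t01 /andP[s0 s1] [a [b sch]].
  (* Moving from [t] to [t + s] multiplies the kernel by [1 + s (K - 1) / Kt t]. Writing [s = r h]
     puts the size of the perturbation into its single coefficient, at most [r L = radius m M], and
     [s <= r / 2] gives [h <= 1/2]. *)
  pose kap (n : nat) z := if n == 1%N then r * ((K z - 1) / Kt t z) else 0.
  pose k (n : nat) : R := if n == 1%N then radius m M else 0.
  have kpos z : 0 < Kt t z by have /andP[u _] := Ktb t z t01; exact: lt_le_trans u.
  have bkap n : bm (kap n).
    rewrite /kap; case: eqP => _; last exact: bm_cst.
    apply: bmZ; apply: bmM; first by apply: bmB => //; exact: bm_cst.
    by apply: (bm_inv m0) => // z; have /andP[] := Ktb t z t01.
  have kapk n z : `|kap n z| <= k n.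
    rewrite /kap /k; case: eqP => _; last by rewrite normr0.
    rewrite normrM gtr0_norm//.
    have /andP[u1 u2] := Ktb t z t01; have /andP[v1 v2] := mKM z.
    have h1 : `|(K z - 1) / Kt t z| <= L.
      rewrite normrM [X in _ * X]gtr0_norm ?invr_gt0//; apply: ler_pM => //.
      + by rewrite invr_ge0 ltW.
      + by rewrite ler_norml; apply/andP; split; lra.
      + by rewrite lef_pV2 ?posrE.
    apply: (@le_trans _ _ (r * L)); first by rewrite ler_pM2l.
    by rewrite /r divfK// gt_eqF.
  have sk : asum k (radius m M).
    move=> [|[|N]]; rewrite ?big_ord_recl ?big_ord0 /= ?normr0 ?add0r ?addr0.
    + by rewrite ltW// radius_gt0.
    + by rewrite ltW// radius_gt0.
    + by rewrite big1 ?addr0 ?gtr0_norm ?radius_gt0// => i _; rewrite normr0.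
  have [al [be [A [_ _ _ _ [_ sol]]]]] :=
    schrodinger_perturb (bKt t) m0 (fun z => Ktb t z t01) sch bkap kapk erefl sk.
  have h1 : `|s / r| < 1.
    have sr : 0 <= s / r by rewrite divr_ge0// ltW.
    by rewrite (ger0_norm sr) ltr_pdivrMr// mul1r; lra.
  have := sol _ h1.
  have -> : (fun z => Kt t z * (1 + ps (kap^~ z) (s / r))) = Kt (t + s).
    apply: funext => z; rewrite ps_single /Kt.
    by field; rewrite gt_eqF//= gt_eqF//; exact: kpos.
  by move=> h; do 2 eexists; exact: h.
have all n : exists a b, schrodinger (Kt (Num.min 1 (n%:R * (r / 2)))) a b.
  elim: n => [|n IH].
    exists (fun=> 1), (fun=> 1); rewrite mul0r min_r//.
    have Kt0 : Kt 0 = fun=> 1 by apply: funext => z; rewrite /Kt mul0r addr0.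
    split; try by split; [exact: bm_cst|exists 1].
      by move=> x; rewrite Kt0 mul1r -[RHS](E_cst nu 1); congr E; apply: funext => y; rewrite mulr1.
    by move=> y; rewrite Kt0 mul1r -[RHS](E_cst mu 1); congr E; apply: funext => x; rewrite mulr1.
  have := step _ (Num.min 1 (n.+1%:R * (r / 2)) - Num.min 1 (n%:R * (r / 2))) _ _ IH.
  rewrite subrKC; apply.
    by rewrite le_min ler01 ge_min lexx /= mulr_ge0// divr_ge0// ltW.
  rewrite -natr1 mulrDl mul1r; set u := n%:R * (r / 2).
  have u2 : 0 < r / 2 by rewrite divr_gt0.
  by apply/andP; split; rewrite /Num.min; case: ifP => ?; case: ifP => ?; lra.
have [n nr] : exists n : nat, 1 <= n%:R * (r / 2).
  have r2 : 0 < r / 2 by rewrite divr_gt0.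
  exists (Num.truncn (r / 2)^-1).+1; rewrite -[X in X <= _](mulVf (lt0r_neq0 r2)).
  rewrite ler_pM2r//; apply: ltW; exact: truncnS_gt.
have [a [b sch]] := all n; exists a, b.
rewrite min_l// in sch.
suff <- : Kt 1 = K by [].
by apply: funext => z; rewrite /Kt mul1r subrKC.
Qed.

End schrodinger.

(** * Densities and entropy *)

Section density_measure.
Context {R : realType} d (T : measurableType d) (q : probability T R) (rho : T -> R).
Hypothesis brho : bm rho.
Hypothesis rho0 : forall x, 0 <= rho x.
Hypothesis rho1 : E q rho = 1.

Definition density_measure (A : set T) : \bar R := (\int[q]_(x in A) (rho x)%:E)%E.

Let dm0 : density_measure set0 = 0%E. Proof. exact: integral_set0. Qed.

Let dm_ge0 A : (0 <= density_measure A)%E.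
Proof. by apply: integral_ge0 => x _; rewrite lee_fin. Qed.

Let dm_sigma : semi_sigma_additive density_measure.
Proof.
move=> /= A mA tA mUA.
rewrite /density_measure integral_bigcup//; last first.
  by apply: (integrableS _ _ (subsetT _)) => //; exact: bm_integrable.
by apply: is_cvg_ereal_nneg_natsum_cond => n _ _; exact: dm_ge0.
Qed.

HB.instance Definition _ := isMeasure.Build _ _ _ density_measure dm0 dm_ge0 dm_sigma.

Let dm_setT : density_measure [set: T] = 1%E.
Proof. by rewrite /density_measure bm_fin// rho1. Qed.

HB.instance Definition _ := Measure_isProbability.Build _ _ _ density_measure dm_setT.

Definition density_probability : probability T R := density_measure.

Lemma density_probabilityP : is_density density_probability q rho.
Proof. by split=> //; split=> //; case: brho. Qed.

End density_measure.

(** For [x > 0], [ln y <= y - 1] at [y = x] and at [y = 1 / x] gives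
    [x - 1 <= x ln x <= x (x - 1)]. *)
Lemma bm_xlnx {R : realType} d (T : measurableType d) (p : T -> R) : bm p -> (forall x, 0 <= p x) -> bm (fun x => p x * ln (p x)).
Proof.
move=> [mp [M pM]] p0; split.
  by apply: measurable_funM => //; exact: measurableT_comp.
exists (1 + M ^+ 2) => x.
have := p0 x; rewrite le_eqVlt => /predU1P[<-|px].
  by rewrite mul0r normr0 addr_ge0// sqr_ge0.
have pMx : p x <= M by apply: le_trans (pM x); exact: ler_norm.
have h1 : ln (p x) <= p x - 1.
  have := @le_ln1Dx R (p x - 1); rewrite subrKC; apply.
  by rewrite ltrBDr addNr.
have h2 : - ln (p x) <= (p x)^-1 - 1.
  rewrite -lnV ?posrE//; have := @le_ln1Dx R ((p x)^-1 - 1); rewrite subrKC; apply.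
  by rewrite ltrBDr addNr invr_gt0.
have h3 : p x * - ln (p x) <= p x * ((p x)^-1 - 1) by rewrite ler_pM2l.
have h4 : p x * ln (p x) <= p x * (p x - 1) by rewrite ler_pM2l.
rewrite mulrBr mulfV ?gt_eqF// in h3.
rewrite ler_norml; apply/andP; split; nra.
Qed.

Section density.
Context {R : realType} d (T : measurableType d) (g q : probability T R).
Implicit Types rho f : T -> R.

Lemma density_dominates rho : is_density g q rho -> g `<< q.
Proof.
move=> [rho0 [mrho grho]]; apply/null_content_dominatesP => A mA qA0.
rewrite grho//; apply: null_set_integral => //.
by apply/measurable_EFinP; exact: measurable_funTS.
Qed.

(** [rho] agrees almost everywhere with the Radon-Nikodym derivative, for which the change of
    variables holds. *)
Lemma density_integral_ge0 rho f : is_density g q rho ->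
  measurable_fun setT f -> (forall x, 0 <= f x) ->
  (\int[g]_x (f x)%:E = \int[q]_x (f x * rho x)%:E)%E.
Proof.
move=> drho mf f0; have dom := density_dominates drho; case: drho => rho0 [mrho grho].
have mf' : measurable_fun setT (EFin \o f) by exact/measurable_EFinP.
have := @Radon_Nikodym_SigmaFinite.change_of_variables _ _ _ g q dom (EFin \o f) setT.
move=> <- //.
have mRN : measurable_fun setT (Radon_Nikodym_SigmaFinite.f g q).
  exact: measurable_int (Radon_Nikodym_SigmaFinite.f_integrable dom).
apply: ge0_ae_eq_integral => //.
- exact: emeasurable_funM.
- by apply/measurable_EFinP; exact: measurable_funM.
- by move=> x _; rewrite mule_ge0 ?lee_fin//; exact: Radon_Nikodym_SigmaFinite.f_ge0.
- by move=> x _; rewrite lee_fin mulr_ge0.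
have : ae_eq q setT (Radon_Nikodym_SigmaFinite.f g q) (EFin \o rho).
  apply: integral_ae_eq => //.
  - exact: Radon_Nikodym_SigmaFinite.f_integrable.
  - exact/measurable_EFinP.
  - by move=> A _ mA; rewrite -Radon_Nikodym_SigmaFinite.f_integral// grho.
by apply: filterS => x + _ => /(_ I) /= ->; rewrite EFinM.
Qed.

Lemma density_integrable rho : is_density g q rho -> q.-integrable setT (EFin \o rho).
Proof.
move=> drho; have [rho0 [mrho grho]] := drho.
apply/integrableP; split; first exact/measurable_EFinP.
rewrite (eq_integral (EFin \o rho)); last by move=> x _ /=; rewrite ger0_norm.
have := grho setT measurableT; rewrite /= => <-.
exact: fin_num_fun_lty.
Qed.

Lemma density_integrableM rho f : is_density g q rho -> bm f ->
  q.-integrable setT (EFin \o (fun x => f x * rho x)).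
Proof.
move=> drho [mf [M fM]]; have [rho0 [mrho _]] := drho.
have iM : q.-integrable setT (fun x => M%:E * (rho x)%:E)%E.
  by apply: integrableZl => //; exact: (density_integrable drho).
apply: (le_integrable measurableT _ _ iM) => //.
  by apply/measurable_EFinP; exact: measurable_funM.
move=> x _ /=; rewrite lee_fin normrM [leRHS]normrM ler_wpM2r//.
by apply: le_trans (fM x) _; exact: ler_norm.
Qed.

(** Adding the bound [M] reduces to a nonnegative integrand; the extra [M] is the same on both sides
    since [rho] has integral one. *)
Lemma density_E rho f : is_density g q rho -> bm f ->
  E g f = E q (fun x => f x * rho x).
Proof.
move=> drho bf; have [mf [M fM]] := bf; have [rho0 [mrho grho]] := drho.
have bfM : bm (fun x => f x + M) by apply: bmD => //; exact: bm_cst.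
have f0 x : 0 <= f x + M.
  by have := fM x; rewrite ler_norml => /andP[+ _]; rewrite -subr_ge0 opprK.
have : E g (fun x => f x + M) = E q (fun x => (f x + M) * rho x).
  by rewrite /E /Rintegral (density_integral_ge0 drho _ f0)//; case: bfM.
rewrite ED ?E_cst//; last exact: bm_cst.
have -> : (fun x => (f x + M) * rho x) = (fun x => f x * rho x + M * rho x).
  by apply: funext => x; rewrite mulrDl.
have ir := density_integrable drho.
have iM : q.-integrable setT (EFin \o (fun x => M * rho x)).
  by apply: density_integrableM => //; exact: bm_cst.
rewrite /E RintegralD//; last exact: density_integrableM.
rewrite RintegralZl//.
have -> : \int[q]_x rho x = 1.
  rewrite /Rintegral -(grho setT measurableT); transitivity (fine (1%E : \bar R)) => //.
  congr fine; exact: probability_setT.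
by rewrite mulr1 => /addIr.
Qed.

(** Gibbs inequality: pointwise [rho ln rho >= rho ln p + rho - p], from [ln y <= y - 1] at
    [y = p / rho]. The last two terms cancel after integration. *)
Lemma entropy_ge rho p : is_density g q rho -> bm p -> E q p = 1 ->
  (exists2 m : R, 0 < m & forall x, m <= p x) ->
  ((E g (fun x => ln (p x)))%:E <= \int[q]_x (rho x * ln (rho x))%:E)%E.
Proof.
move=> drho bp p1 [m m0 mp]; have [rho0 [mrho grho]] := drho.
have blp : bm (fun x => ln (p x)) by exact: (bm_ln m0).
pose u x := ln (p x) * rho x + rho x - p x.
have ir := density_integrable drho.
have il := density_integrableM drho blp.
have ip := bm_integrable q bp.
have r1 : \int[q]_x rho x = 1.
  rewrite /Rintegral -(grho setT measurableT); transitivity (fine (1%E : \bar R)) => //.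
  congr fine; exact: probability_setT.
have ilr : q.-integrable setT (EFin \o (fun x => ln (p x) * rho x + rho x)).
  have := integrableD measurableT il ir; exact.
have iu : q.-integrable setT (EFin \o u).
  have := integrableB measurableT ilr ip; exact.
have Eu : \int[q]_x u x = E g (fun x => ln (p x)).
  rewrite RintegralB// RintegralD// r1 -/(E q p) p1 addrK.
  by rewrite (density_E drho blp).
have -> : (E g (fun x => ln (p x)))%:E = (\int[q]_x (u x)%:E)%E.
  by rewrite -Eu /Rintegral fineK//; exact: (integrable_fin_num measurableT iu).
have ule x : u x <= rho x * ln (rho x).
  have px : 0 < p x by exact: lt_le_trans (mp x).
  rewrite /u; have := rho0 x; rewrite le_eqVlt => /predU1P[<-|rx].
    by rewrite mulr0 mul0r add0r sub0r oppr_le0 ltW.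
  have := @le_ln1Dx R (p x / rho x - 1); rewrite subrKC ltrBDr addNr => /(_ _).
  rewrite divr_gt0// => /(_ isT); rewrite ln_div ?posrE// => h.
  have : rho x * (ln (p x) - ln (rho x)) <= rho x * (p x / rho x - 1) by rewrite ler_pM2l.
  rewrite mulrBr (mulrBr _ (p x / rho x)) mulrCA mulfV ?gt_eqF// !mulr1; lra.
(* [rho ln rho] may fail to be integrable, so the pointwise bound is transferred through positive
   and negative parts. *)
rewrite [leLHS]integralE [leRHS]integralE.
have mr : measurable_fun setT (fun x => (rho x * ln (rho x))%:E).
  by apply/measurable_EFinP; apply: measurable_funM => //; exact: measurableT_comp.
have mu : measurable_fun setT (EFin \o u) by exact: measurable_int iu.
apply: leeB.
- apply: ge0_le_integral => //.
  + exact: measurable_funepos.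
  + exact: measurable_funepos.
  + move=> x _; apply: (@funepos_le _ _ setT) => //; last by rewrite inE.
    by move=> y _; rewrite lee_fin.
- apply: ge0_le_integral => //.
  + exact: measurable_funeneg.
  + exact: measurable_funeneg.
  + move=> x _; apply: (@funeneg_le _ _ setT) => //; last by rewrite inE.
    by move=> y _; rewrite lee_fin.
Qed.

(** [Ent] is computed with a density picked by choice; two densities agree almost everywhere, so any
    bounded one gives the same value. *)
Lemma Ent_bm p : is_density g q p -> bm p ->
  Ent g q = (E q (fun x => p x * ln (p x)))%:E.
Proof.
move=> dp bp; rewrite /Ent; case: pselect => [h|nh]; last by case: nh; exists p.
case: cid => rho /= drho.
have [p0 [mp gp]] := dp; have [rho0 [mrho grho]] := drho.
rewrite -bm_fin; last exact: bm_xlnx.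
have ae : ae_eq q setT (EFin \o rho) (EFin \o p).
  apply: integral_ae_eq => //.
  - exact: density_integrable.
  - exact/measurable_EFinP.
  - by move=> A _ mA; rewrite -grho// gp.
apply: ae_eq_integral => //.
- by apply/measurable_EFinP; apply: measurable_funM => //; exact: measurableT_comp.
- by apply/measurable_EFinP; apply: measurable_funM => //; exact: measurableT_comp.
- by apply: filterS ae => x /(_ I) /= [->].
Qed.

Lemma Ent_ge p : bm p -> E q p = 1 -> (exists2 m : R, 0 < m & forall x, m <= p x) ->
  ((E g (fun x => ln (p x)))%:E <= Ent g q)%E.
Proof.
move=> bp p1 mp; rewrite /Ent; case: pselect => [h|nh]; last by rewrite leey.
by case: cid => rho /= drho; exact: entropy_ge.
Qed.

Lemma Ent_ge0 : (0 <= Ent g q)%E.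
Proof.
have := @Ent_ge (fun=> 1) (bm_cst _ 1); rewrite E_cst => /(_ erefl).
have -> : (fun _ : T => ln (1 : R)) = fun=> 0 by apply: funext => x; rewrite ln1.
by rewrite E_cst; apply; exists 1.
Qed.

End density.

(** * The value function *)

Lemma E_push {R : realType} d d' (X : measurableType d) (Y : measurableType d')
    (g : probability X R) (m : probability Y R) (phi : X -> Y) (f : Y -> R) :
  measurable_fun setT phi -> (forall A, measurable A -> g (phi @^-1` A) = m A) ->
  bm f -> E g (f \o phi) = E m f.
Proof.
move=> mphi gm bf.
have bfp : bm (f \o phi) by exact: bm_comp.
have [mf _] := bf; have mf' : measurable_fun setT (EFin \o f) by exact/measurable_EFinP.
have int : g.-integrable (phi @^-1` setT) ((EFin \o f) \o phi).
  by rewrite preimage_setT; exact: (bm_integrable g bfp).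
congr fine; have := integral_pushforward mphi mf' int measurableT.
rewrite preimage_setT => <-.
by apply: eq_measure_integral => A mA _; exact: gm.
Qed.

Section transport.
Context {R : realType} d1 d2 (T1 : measurableType d1) (T2 : measurableType d2).
Variables (mu : probability T1 R) (nu : probability T2 R) (c : T1 * T2 -> R).
Hypothesis bc : bm c.
Implicit Types (g : probability (T1 * T2)%type R) (eps s t l H : R).

Definition marginals g :=
  (forall A, measurable A -> g (A `*` setT) = mu A) /\
  (forall B, measurable B -> g (setT `*` B) = nu B).

Let q : probability (T1 * T2)%type R := (mu \x nu)%E.

Lemma marginals_fst g f : marginals g -> bm f -> E g (fun z => f z.1) = E mu f.
Proof.
move=> [g1 _] bf; rewrite -(@E_push _ _ _ (T1 * T2)%type T1 g mu fst)// => A mA.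
by rewrite -g1//; congr (g _); apply/seteqP; split=> -[x y] //= [].
Qed.

Lemma marginals_snd g f : marginals g -> bm f -> E g (fun z => f z.2) = E nu f.
Proof.
move=> [_ g2] bf; rewrite -(@E_push _ _ _ (T1 * T2)%type T2 g nu snd)// => A mA.
by rewrite -g2//; congr (g _); apply/seteqP; split=> -[x y] //= [].
Qed.

(** The marginal conditions are tested against bounded functions because block densities have row
    and column integrals equal to one only off null cells. *)
Lemma density_marginals p : bm p -> (forall z, 0 <= p z) ->
  (forall f, bm f -> E q (fun z => f z.1 * p z) = E mu f) ->
  (forall f, bm f -> E q (fun z => f z.2 * p z) = E nu f) ->
  exists2 g, marginals g & is_density g q p.
Proof.
move=> bp p0 p1 p2.
have pE : E q p = 1.
  rewrite -(E_cst mu 1) -p1; last exact: bm_cst.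
  by congr E; apply: funext => z; rewrite mul1r.
pose g := density_probability bp p0 pE; exists g; last exact: density_probabilityP.
have indE d (T : measurableType d) (m : probability T R) (A : set T) :
    measurable A -> m A = (E m (\1_A))%:E.
  move=> mA; rewrite -bm_fin; last first.
    by split; [exact: measurable_indic|exists 1 => x; rewrite indicE ger0_norm ?lern1 ?ler0n //; case: (_ \in _)].
  by rewrite integral_indic// setIT.
have bm1 d (T : measurableType d) (A : set T) : measurable A -> bm (\1_A : T -> R).
  move=> mA; split; first exact: measurable_indic.
  by exists 1 => x; rewrite indicE; case: (_ \in _); rewrite ?normr1 ?normr0.
have gE A : measurable A -> g A = (E q (fun z => \1_A z * p z))%:E.
  move=> mA; rewrite indE// (density_E (density_probabilityP bp p0 pE))//; exact: bm1.
split=> [A mA|B mB].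
  rewrite gE; last exact: measurableX.
  rewrite [in RHS]indE// -p1; last exact: bm1.
  congr (E _ _)%:E; apply: funext => z; congr (_ * _); rewrite !indicE.
  suff -> : (z \in A `*` [set: T2]) = (z.1 \in A) by [].
  by apply/idP/idP; rewrite !inE /= => // -[].
rewrite gE; last exact: measurableX.
rewrite [in RHS]indE// -p2; last exact: bm1.
congr (E _ _)%:E; apply: funext => z; congr (_ * _); rewrite !indicE.
suff -> : (z \in [set: T1] `*` B) = (z.2 \in B) by [].
by apply/idP/idP; rewrite !inE /= => // -[].
Qed.

(** Since [0 * +oo = 0] in the extended reals, [eps = 0] gives the unregularized cost, and one
    definition covers [v_ot] and [v_ent]. *)
Definition objective (eps : R) g : \bar R := ((E g c)%:E + eps%:E * Ent g q)%E.
Definition value (eps : R) : \bar R := ereal_inf (objective eps @` marginals).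
Definition rvalue (eps : R) : R := fine (value eps).

(** A competitor of zero entropy, which keeps every value below [+oo]. *)
Lemma product_marginals : marginals q /\ Ent q q = 0%:E.
Proof.
have dq : is_density q q (fun=> 1).
  split=> //; split; first exact: measurable_cst.
  by move=> A mA; rewrite integral_cst// mul1e.
split; last first.
  rewrite (Ent_bm dq (bm_cst _ 1)); congr EFin; rewrite -(E_cst q 0); congr E.
  by apply: funext => z; rewrite ln1 mulr0.
split=> [A mA|B mB]; rewrite /q /= product_measure1E//.
  by rewrite [X in (_ * X)%E](probability_setT nu) mule1.
by rewrite [X in (X * _)%E](probability_setT mu) mul1e.
Qed.

Lemma value_fin eps : 0 <= eps -> value eps = (rvalue eps)%:E.
Proof.
move=> e0; rewrite /rvalue fineK//; have [_ [M cM]] := bc.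
have [mq eq0] := product_marginals.
rewrite fin_numElt; apply/andP; split.
  apply: (@lt_le_trans _ _ (- M)%:E); first exact: ltNyr.
  apply: le_ereal_inf_tmp => _ [g mg <-].
  apply: (@le_trans _ _ (E g c)%:E).
    rewrite lee_fin; have : `|E g c| <= M by exact: E_norm.
    by rewrite ler_norml => /andP[].
  by rewrite leeDl// mule_ge0 ?lee_fin// Ent_ge0.
apply: (@le_lt_trans _ _ (objective eps q)).
  by apply: ge_ereal_inf; exists (objective eps q) => //; exists q.
by rewrite /objective eq0 mule0 adde0 ltry.
Qed.

Lemma rvalue_le eps g H : 0 <= eps -> marginals g -> Ent g q = H%:E ->
  rvalue eps <= E g c + eps * H.
Proof.
move=> e0 mg gH; rewrite -lee_fin -value_fin//.
by apply: ge_ereal_inf; exists (objective eps g); [exists g|rewrite /objective gH].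
Qed.

(** For [eps > 0] a coupling of infinite entropy has objective [+oo] and can be ignored. At
    [eps = 0] it counts, which is why [rvalue0_ge] quantifies over all couplings. *)
Lemma rvalue_ge eps l : 0 < eps ->
  (forall g H, marginals g -> Ent g q = H%:E -> l <= E g c + eps * H) -> l <= rvalue eps.
Proof.
move=> e0 h; rewrite -lee_fin -value_fin; last exact: ltW.
apply: le_ereal_inf_tmp => _ [g mg <-]; rewrite /objective.
have := Ent_ge0 g q; case E : (Ent g q) => [H| |] // _.
  by rewrite lee_fin; exact: h.
by rewrite gt0_muley ?lte_fin// addey// leey.
Qed.

Lemma rvalue0_ge l : (forall g, marginals g -> l <= E g c) -> l <= rvalue 0.
Proof.
move=> h; rewrite -lee_fin -value_fin//.
by apply: le_ereal_inf_tmp => _ [g mg <-]; rewrite /objective mul0e adde0 lee_fin h.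
Qed.

Lemma Ent_fin_ge0 g H : Ent g q = H%:E -> 0 <= H.
Proof. by move=> gH; have := Ent_ge0 g q; rewrite gH lee_fin. Qed.

Lemma rvalue_nondecreasing (x y : R) : 0 <= x -> x <= y -> rvalue x <= rvalue y.
Proof.
move=> x0; rewrite le_eqVlt => /predU1P[->//|xy]; apply: rvalue_ge.
  exact: le_lt_trans xy.
move=> g H mg gH; apply: le_trans (rvalue_le x0 mg gH) _.
by rewrite lerD2l ler_wpM2r ?(ltW xy)// (Ent_fin_ge0 gH).
Qed.

Lemma rvalue_concave (x y t : R) : 0 <= x -> 0 <= y -> 0 <= t <= 1 ->
  (1 - t) * rvalue x + t * rvalue y <= rvalue ((1 - t) * x + t * y).
Proof.
move=> x0 y0 /andP[t0 t1]; have t1' : 0 <= 1 - t by rewrite subr_ge0.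
set z := _ + t * y.
have z0 : 0 <= z by rewrite addr_ge0// mulr_ge0.
(* The lower bound through finite entropies needs [z > 0]. When [z = 0] each endpoint is zero or has
   zero weight, and the inequality degenerates to an equality. *)
move: z0; rewrite le_eqVlt => /predU1P[z0|zpos]; last first.
  apply: rvalue_ge => // g H mg gH.
  have h1 := ler_wpM2l t1' (rvalue_le x0 mg gH).
  have h2 := ler_wpM2l t0 (rvalue_le y0 mg gH).
  by rewrite /z; lra.
rewrite -z0; have : (1 - t) * x == 0 /\ t * y == 0.
  have : (1 - t) * x + t * y == 0 by rewrite eq_sym -/z z0.
  by rewrite paddr_eq0 ?mulr_ge0// => /andP[].
rewrite !mulf_eq0 subr_eq0 => -[/orP[/eqP tE|/eqP xE] /orP[/eqP tE'|/eqP yE]].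
- by move: tE; rewrite tE' => /eqP; rewrite oner_eq0.
- by rewrite -tE yE; lra.
- by rewrite tE' xE; lra.
- by rewrite xE yE; lra.
Qed.

(** Since [ln p = ln a + ln b - s c], every coupling has [E g (ln p) = F - s E g c]. The Gibbs
    inequality makes [F] a lower bound for [s E g c + Ent], attained by the coupling with density
    [p]. Using this same coupling as a competitor at [s'] gives the supergradient line. *)
Lemma rvalue_schrodinger s a b : 0 < s ->
  schrodinger mu nu (fun z => expR (- (s * c z))) a b ->
  let F := E mu (fun x => ln (a x)) + E nu (fun y => ln (b y)) in
  let p := gibbs (fun z => expR (- (s * c z))) a b in
  s * rvalue s^-1 = F /\
  (forall s' : R, 0 < s' -> s' * rvalue s'^-1 <= F + (s' - s) * E q (fun z => c z * p z)).
Proof.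
move=> s0; set K := (fun z => expR _) => sch F p.
have [_ [M cM]] := bc.
have bK : bm K by apply: bm_expR; apply: bmN; exact: bmZ.
have KM z : expR (- (s * M)) <= K z <= expR (s * M).
  have := cM z; rewrite ler_norml => /andP[u v].
  by rewrite !ler_expR; apply/andP; split; nra.
have bist := gibbs_bistochastic bK (expR_gt0 _) KM sch; set dl := _ ^+ 2 in bist.
have dl0 : 0 < dl by rewrite exprn_gt0// divr_gt0// expR_gt0.
have [bp pdl pE1 pE2] := bist.
have p0 z : 0 <= p z by apply: le_trans (pdl z); exact: ltW.
have pE f : bm f -> E q (fun z => f z.1 * p z) = E mu f.
  move=> bf.
  have bfp : bm (fun z => f z.1 * p z) by apply: bmM => //; exact: (@bm_fst R _ _ T1 T2 _ bf).
  rewrite -(fubini12 mu nu bfp); congr E; apply: funext => x /=.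
  by rewrite EZ; [rewrite pE1 mulr1|exact: bm_sec1].
have pE' f : bm f -> E q (fun z => f z.2 * p z) = E nu f.
  move=> bf.
  have bfp : bm (fun z => f z.2 * p z) by apply: bmM => //; exact: (@bm_snd R _ _ T1 T2 _ bf).
  rewrite -(fubini21 mu nu bfp); congr E; apply: funext => x /=.
  by rewrite EZ; [rewrite pE2 mulr1|exact: bm_sec2].
have Ep : E q p = 1.
  rewrite -(E_cst mu 1) -(pE _ (bm_cst _ 1)); congr E.
  by apply: funext => z; rewrite mul1r.
case: sch => -[ba [ma ma0 am]] [bb [mb mb0 bmb]] _ _.
have bla := bm_ln ma0 am ba; have blb := bm_ln mb0 bmb bb.
have lnp z : ln (p z) = ln (a z.1) + ln (b z.2) - s * c z.
  have az : 0 < a z.1 by exact: lt_le_trans (am _).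
  have bz : 0 < b z.2 by exact: lt_le_trans (bmb _).
  rewrite /p /gibbs lnM ?posrE ?mulr_gt0 ?expR_gt0// lnM ?posrE ?expR_gt0// expRK; lra.
have Elnp g : marginals g -> E g (fun z => ln (p z)) = F - s * E g c.
  move=> mg; rewrite (_ : (fun z => _) = fun z => (ln (a z.1) + ln (b z.2)) - s * c z); last first.
    by apply: funext => z; rewrite lnp.
  have b1 := @bm_fst R _ _ T1 T2 _ bla; have b2 := @bm_snd R _ _ T1 T2 _ blb.
  rewrite EB ?EZ//; [|exact: bmD|exact: bmZ].
  rewrite ED// (marginals_fst (f := fun x => ln (a x)) mg bla).
  by rewrite (marginals_snd (f := fun x => ln (b x)) mg blb).
have [g mg dg] := density_marginals bp p0 pE pE'.
have gc : E g c = E q (fun z => c z * p z) by exact: density_E.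
have blp : bm (fun z => ln (p z)) by exact: (bm_ln dl0 pdl bp).
have gH : Ent g q = (F - s * E g c)%:E.
  rewrite (Ent_bm dg bp) -Elnp// (density_E dg blp); congr (E _ _)%:E.
  by apply: funext => z; rewrite mulrC.
have envelope s' : 0 < s' -> s' * rvalue s'^-1 <= F + (s' - s) * E q (fun z => c z * p z).
  move=> s'0; have s'V : 0 <= s'^-1 by rewrite invr_ge0 ltW.
  have := rvalue_le s'V mg gH; rewrite -(ler_pM2l s'0) mulrDr mulrA mulfV ?gt_eqF// mul1r gc; lra.
split=> //; apply/eqP; rewrite eq_le; apply/andP; split.
  by apply: le_trans (envelope _ s0) _; rewrite subrr mul0r addr0.
rewrite -ler_pdivrMl//; apply: rvalue_ge; first by rewrite invr_gt0.
move=> g' H mg' g'H.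
have := @Ent_ge _ _ _ g' q p bp Ep (ex_intro2 _ _ dl dl0 pdl).
rewrite g'H lee_fin Elnp// => h.
have : s^-1 * (F - s * E g' c) <= s^-1 * H by rewrite ler_pM2l// invr_gt0.
by rewrite mulrBr mulrA mulVf ?gt_eqF// mul1r; lra.
Qed.

End transport.

(** * Analyticity *)

Section antiderivative.
Context {R : realType}.
Implicit Types (x y h A B u : R) (a b w : nat -> R).

(** The radius [1/2] absorbs the factor [n] of the derivative of [x^n], so the Lipschitz constant is
    the same for all [n]. *)
Lemma norm_subX_le x y n : `|x| <= 2^-1 -> `|y| <= 2^-1 -> `|x ^+ n - y ^+ n| <= `|x - y|.
Proof.
move=> hx hy; elim: n => [|[|n] IH]; first by rewrite !expr0 subrr normr0.
  by rewrite !expr1.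
have -> : x ^+ n.+2 - y ^+ n.+2 = x * (x ^+ n.+1 - y ^+ n.+1) + (x - y) * y ^+ n.+1.
  by rewrite !(exprS _ n.+1); ring.
apply: le_trans (ler_normD _ _) _; rewrite !normrM.
have h1 : `|x| * `|x ^+ n.+1 - y ^+ n.+1| <= 2^-1 * `|x - y| by exact: ler_pM.
have h2 : `|x - y| * `|y ^+ n.+1| <= `|x - y| * 2^-1.
  apply: ler_wpM2l => //; rewrite normrX exprS.
  have y1 : `|y| <= 1 by apply: le_trans hy _; lra.
  by apply: le_trans hy; rewrite ler_piMr// exprn_ile1.
lra.
Qed.

(** The constant [2] is stable under the recursion: it is halved by [|y| <= 1/2], and the increment
    bound adds [1]. *)
Lemma norm_taylorX_le x y n : `|x| <= 2^-1 -> `|y| <= 2^-1 ->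
  `|x ^+ n.+1 - y ^+ n.+1 - n.+1%:R * (x - y) * y ^+ n| <= 2 * `|x - y| ^+ 2.
Proof.
move=> hx hy; elim: n => [|n IH].
  by rewrite !expr1 expr0 mulr1 mul1r subrr normr0 mulr_ge0// exprn_ge0.
have -> : x ^+ n.+2 - y ^+ n.+2 - n.+2%:R * (x - y) * y ^+ n.+1 =
  y * (x ^+ n.+1 - y ^+ n.+1 - n.+1%:R * (x - y) * y ^+ n)
   + (x - y) * (x ^+ n.+1 - y ^+ n.+1).
  by rewrite -[n.+2%:R]natr1 !exprS; ring.
apply: le_trans (ler_normD _ _) _; rewrite !normrM.
have h1 := ler_pM (normr_ge0 y) (normr_ge0 _) hy IH.
have h2 : `|x - y| * `|x ^+ n.+1 - y ^+ n.+1| <= `|x - y| * `|x - y|.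
  by apply: ler_wpM2l => //; exact: norm_subX_le.
rewrite expr2 in h1 *; lra.
Qed.

(** Cutting the segment from [0] to [x] into [n + 1] equal pieces bounds the total variation by
    [L |x|^2 / (n + 1)]. *)
Lemma quadratic_constant (D : R -> R) (L : R) : 0 <= L ->
  (forall x y, `|x| <= 2^-1 -> `|y| <= 2^-1 -> `|D x - D y| <= L * `|x - y| ^+ 2) ->
  forall x, `|x| <= 2^-1 -> D x = D 0.
Proof.
move=> L0 DL x hx; apply/eqP; rewrite -subr_eq0 -normr_le0.
have key n : `|D x - D 0| <= L * `|x| ^+ 2 / n.+1%:R.
  pose p i : R := x * (i%:R / n.+1%:R).
  have n0 : (n.+1%:R : R) != 0 by rewrite pnatr_eq0.
  have px i : (i <= n.+1)%N -> `|p i| <= 2^-1.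
    move=> ni; apply: le_trans hx; rewrite normrM ler_piMr//.
    by rewrite ger0_norm ?divr_ge0// ler_pdivrMr ?ltr0n// mul1r ler_nat.
  have -> : D x - D 0 = \sum_(0 <= i < n.+1) (D (p i.+1) - D (p i)).
    by rewrite telescope_sumr// /p mulfV// mulr1 mul0r mulr0.
  apply: le_trans (ler_norm_sum _ _ _) _.
  rewrite big_mkord; apply: (@le_trans _ _ (\sum_(i < n.+1) L * (`|x| ^+ 2 / n.+1%:R ^+ 2))).
    apply: ler_sum => i _; apply: le_trans (DL _ _ _ _) _.
    - by apply: px; exact: ltn_ord.
    - by apply: px; exact: ltnW.
    - rewrite /p -mulrBr -mulrBl -natr1 addrC addKr mul1r normrM exprMn.
      have ni : 0 <= n.+1%:R^-1 :> R by rewrite invr_ge0 ler0n.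
      by rewrite (ger0_norm ni) exprVn.
  by rewrite sumr_const card_ord -[X in X <= _]mulr_natr le_eqVlt; apply/orP; left; apply/eqP; field.
have : (fun n => L * `|x| ^+ 2 / n.+1%:R) @ \oo --> L * `|x| ^+ 2 * 0.
  by apply: cvgM; [exact: cvg_cst|exact: cvg_harmonic].
rewrite mulr0 => cv.
rewrite -[X in _ <= X](lim_eq cv); apply: limr_ge; first exact: cvgP cv.
exact: nearW.
Qed.

(** Coefficients of [f0 + r * int_0^h C]; the factor [r] comes from the substitution
    [s = s0 + r h]. *)
Definition antider (f0 r : R) (C : nat -> R) n : R := if n is m.+1 then r * C m / m.+1%:R else f0.

Lemma asum_antider (f0 r : R) (C : nat -> R) A : 0 <= r -> asum C A -> asum (antider f0 r C) (`|f0| + r * A).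
Proof.
move=> r0 sC [|N]; first by rewrite big_ord0 addr_ge0// mulr_ge0// (asum_ge0 sC).
rewrite big_ord_recl /= lerD2l; apply: le_trans (asumZ r0 sC N).
apply: ler_sum => i _; rewrite !normrM ler_piMr//.
by rewrite ger0_norm ?invr_ge0// invf_le1 ?ltr0n// ler1n.
Qed.

(* The hypothesis says that [r * ps C h] is a supergradient of [f] at [h]. *)
Lemma ps_at0 a : ps a 0 = a 0%N.
Proof.
apply: lim_eq; rewrite -cvg_shiftS /=.
have -> : (fun n => series (fun n => a n * 0 ^+ n) n.+1) = fun=> a 0%N.
  apply: funext => n; rewrite seriesEord /= big_ord_recl /= expr0 mulr1 big1 ?addr0// => i _.
  by rewrite exprS mul0r mulr0.
exact: cvg_cst.
Qed.

(** Used in both orders, the supergradient inequality traps [f x - f y - r (x - y) C y] between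
    [r (x - y) (C x - C y)] and [0], which is quadratic because [C] is Lipschitz on the half disc.
    The series [G] obeys the same kind of estimate, so [f - G] varies quadratically and is
    constant. *)
Lemma antiderivative (f : R -> R) (r : R) (C : nat -> R) A : 0 <= r -> asum C A ->
  (forall h h', `|h| < 1 -> `|h'| < 1 -> f h' <= f h + r * (h' - h) * ps C h) ->
  forall h, `|h| <= 2^-1 -> f h = ps (antider (f 0) r C) h.
Proof.
move=> r0 sC fC; have A0 := asum_ge0 sC.
pose G := ps (antider (f 0) r C); have sG := asum_antider (f 0) r0 sC.
have lt1 h : `|h| <= 2^-1 -> `|h| < 1 by move=> hh; apply: le_lt_trans hh _; lra.
have GL x y : `|x| <= 2^-1 -> `|y| <= 2^-1 ->
    `|G x - G y - r * (x - y) * ps C y| <= r * A * (2 * `|x - y| ^+ 2).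
  move=> hx hy; have x1 := ltW (lt1 _ hx); have y1 := ltW (lt1 _ hy).
  (* One term more than the partial sum of [C]: the constant terms cancel in differences, and the
     other [N] match those of [C]. *)
  pose S N h := series (fun n => antider (f 0) r C n * h ^+ n) N.+1.
  have cS h : `|h| <= 1 -> S^~ h @ \oo --> G h.
    by move=> h1; rewrite /S (cvg_shiftS (series _)); exact: ps_cvg sG h1.
  have cv : (fun N => `|S N x - S N y - r * (x - y) * series (fun n => C n * y ^+ n) N|) @ \oo -->
     `|G x - G y - r * (x - y) * ps C y|.
    apply: cvg_norm; apply: cvgB; first by apply: cvgB; exact: cS.
    by apply: cvgM; [exact: cvg_cst|exact: ps_cvg sC y1].
  rewrite -(lim_eq cv); apply: limr_le; first exact: cvgP cv.
  apply: nearW => N; rewrite /S !seriesEord /= !big_ord_recl /= !expr0.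
  rewrite opprD addrACA subrr add0r -sumrB mulr_sumr -sumrB.
  apply: le_trans (ler_norm_sum _ _ _) _.
  apply: (@le_trans _ _ (\sum_(n < N) r * `|C n| * (2 * `|x - y| ^+ 2))).
    apply: ler_sum => n _; rewrite /bump /= add1n.
    have n0 : (n.+1%:R : R) != 0 by rewrite pnatr_eq0.
    have -> : r * C n / n.+1%:R * x ^+ n.+1 - r * C n / n.+1%:R * y ^+ n.+1 -
        r * (x - y) * (C n * y ^+ n) =
      r * C n * ((x ^+ n.+1 - y ^+ n.+1 - n.+1%:R * (x - y) * y ^+ n) / n.+1%:R).
      by field.
    rewrite normrM normrM (ger0_norm r0) ler_wpM2l ?mulr_ge0//.
    apply: le_trans (norm_taylorX_le n hx hy); rewrite normrM ler_piMr//.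
    by rewrite ger0_norm ?invr_ge0// invf_le1 ?ltr0n// ler1n.
  by rewrite -mulr_suml -mulr_sumr ler_wpM2r ?mulr_ge0 ?exprn_ge0// ler_wpM2l.
have CL x y : `|x| <= 2^-1 -> `|y| <= 2^-1 -> `|ps C x - ps C y| <= A * `|x - y|.
  move=> hx hy; have x1 := ltW (lt1 _ hx); have y1 := ltW (lt1 _ hy).
  have cv : (fun N => `|series (fun n => C n * x ^+ n) N - series (fun n => C n * y ^+ n) N|)
     @ \oo --> `|ps C x - ps C y|.
    by apply: cvg_norm; apply: cvgB; [exact: ps_cvg sC x1|exact: ps_cvg sC y1].
  rewrite -(lim_eq cv); apply: limr_le; first exact: cvgP cv.
  apply: nearW => N; rewrite !seriesEord /= -sumrB.
  apply: le_trans (ler_norm_sum _ _ _) _.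
  apply: (@le_trans _ _ (\sum_(n < N) `|C n| * `|x - y|)).
    by apply: ler_sum => n _; rewrite -mulrBr normrM ler_wpM2l// norm_subX_le.
  by rewrite -mulr_suml ler_wpM2r.
have fL x y : `|x| <= 2^-1 -> `|y| <= 2^-1 ->
    `|f x - f y - r * (x - y) * ps C y| <= r * A * `|x - y| ^+ 2.
  move=> hx hy; have u1 := fC _ _ (lt1 _ hx) (lt1 _ hy); have u2 := fC _ _ (lt1 _ hy) (lt1 _ hx).
  have h3 : `|r * (x - y) * (ps C x - ps C y)| <= r * A * `|x - y| ^+ 2.
    rewrite !normrM (ger0_norm r0) expr2 -mulrA -[leRHS]mulrA ler_wpM2l//.
    by rewrite [leRHS]mulrA [leRHS]mulrC ler_wpM2l// CL.
  have [v1 v2] := ler_normlP _ _ h3; apply/ler_normlP; split; lra.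
move=> h hh; have D0 := @quadratic_constant (fun x => f x - G x) (r * A + r * A * 2) _ _ h hh.
have G0 : G 0 = f 0 by rewrite /G ps_at0.
rewrite G0 subrr in D0; apply/eqP; rewrite -subr_eq0; apply/eqP; apply: D0.
  by rewrite addr_ge0// !mulr_ge0.
move=> x y hx hy.
have [v1 v2] := ler_normlP _ _ (fL x y hx hy).
have [w1 w2] := ler_normlP _ _ (GL x y hx hy).
apply/ler_normlP; split; lra.
Qed.

End antiderivative.

(** * Composition of power series *)

Section composition.
Context {R : realType}.
Implicit Types (u A B : R) (a b w : nat -> R).

Definition wpow w n := iter n (conv w) (@one_seq R).

Lemma asum_wpow w B n : asum w B -> asum (wpow w n) (B ^+ n).
Proof.
move=> sw; elim: n => [|n IH] /=; first by rewrite expr0; exact: asum_one.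
by rewrite exprS; exact: asum_conv.
Qed.

Lemma ps_wpow w B n u : asum w B -> `|u| < 1 -> ps (wpow w n) u = ps w u ^+ n.
Proof.
move=> sw u1; elim: n => [|n IH] /=; first by rewrite expr0 ps_one.
by rewrite exprS -IH; apply: (ps_conv sw (asum_wpow n sw) u1).
Qed.

Lemma wpow_lt w n k : w 0%N = 0 -> (k < n)%N -> wpow w n k = 0.
Proof.
move=> w0; elim: n k => [//|n IH] k kn /=; rewrite /conv big1// => -[i ik] _ /=.
have [->|i0] := eqVneq i 0%N; first by rewrite w0 mul0r.
rewrite IH ?mulr0//; rewrite ltnS in kn; apply: leq_trans kn.
by rewrite ltn_subrL lt0n i0; case: k ik {IH} => //; case: i i0.
Qed.

Lemma ps_tail a A u N : asum a A -> `|u| <= 1 ->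
  `|ps a u - series (fun n => a n * u ^+ n) N| <= A * `|u| ^+ N.
Proof.
move=> sa u1.
have cv : (fun m => `|series (fun n => a n * u ^+ n) m - series (fun n => a n * u ^+ n) N|) @ \oo
   --> `|ps a u - series (fun n => a n * u ^+ n) N|.
  by apply: cvg_norm; apply: cvgB; [exact: ps_cvg sa u1|exact: cvg_cst].
rewrite -(lim_eq cv); apply: limr_le; first exact: cvgP cv.
near=> m; have Nm : (N <= m)%N by near: m; exact: nbhs_infty_ge.
rewrite sub_series_geq//; apply: le_trans (ler_norm_sum _ _ _) _.
apply: (@le_trans _ _ (\sum_(N <= k < m) `|a k| * `|u| ^+ N)).
  rewrite big_nat [leRHS]big_nat; apply: ler_sum => k /andP[Nk _].
  by rewrite normrM normrX ler_wpM2l// ler_wiXn2l.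
rewrite -mulr_suml ler_wpM2r ?exprn_ge0//; apply: le_trans (sa m).
have -> : \sum_(n < m) `|a n| = \sum_(0 <= n < N) `|a n| + \sum_(N <= n < m) `|a n|.
  by rewrite -(big_mkord xpredT (fun k => `|a k|)) (@big_cat_nat _ _ _ N).
by rewrite lerDr; exact: sumr_ge0.
Unshelve. all: end_near. Qed.

(** The cut at [n <= k] loses nothing when [w 0 = 0], since the [n]-th power of [w] then starts at
    order [n]. *)
Definition compose a w k := \sum_(n < k.+1) a n * wpow w n k.

Lemma compose_widen a w N (k : 'I_N) : w 0%N = 0 ->
  compose a w k = \sum_(n < N) a n * wpow w n k.
Proof.
move=> w0; rewrite /compose (big_ord_widen N (fun n => a n * wpow w n k))//.
rewrite big_mkcond; apply: eq_bigr => n _; case: ltnP => // kn.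
by rewrite wpow_lt ?mulr0.
Qed.

Lemma asum_compose a w A B : asum a A -> asum w B -> B <= 1 -> w 0%N = 0 ->
  asum (compose a w) A.
Proof.
move=> sa sw B1 w0 N; have B0 := asum_ge0 sw; apply: le_trans (sa N).
apply: (@le_trans _ _ (\sum_(k < N) \sum_(n < N) `|a n| * `|wpow w n k|)).
  apply: ler_sum => k _; rewrite compose_widen//; apply: le_trans (ler_norm_sum _ _ _) _.
  by apply: ler_sum => n _; rewrite normrM.
rewrite exchange_big /=; apply: ler_sum => n _; rewrite -mulr_sumr ler_piMr//.
by apply: le_trans (asum_wpow n sw N) _; rewrite exprn_ile1.
Qed.

(** The partial sums up to [N] differ by the sum of [a n] times the tail of [w^n] beyond order [N].
    As [B <= 1] bounds all powers of [w] alike, this is at most [A |u|^N]. *)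
Lemma ps_compose a w A B u : asum a A -> asum w B -> B <= 1 -> w 0%N = 0 -> `|u| < 1 ->
  ps (compose a w) u = ps a (ps w u).
Proof.
move=> sa sw B1 w0 u1; have u1' := ltW u1; have A0 := asum_ge0 sa; have B0 := asum_ge0 sw.
have wu1 : `|ps w u| <= 1 by apply: le_trans (ps_le sw u1') B1.
have cv : (fun N => series (fun n => a n * ps w u ^+ n) N - series (fun k => compose a w k * u ^+ k) N)
   @ \oo --> ps a (ps w u) - ps (compose a w) u.
  apply: cvgB; first exact: ps_cvg sa wu1.
  exact: ps_cvg (asum_compose sa sw B1 w0) u1'.
apply/eqP; rewrite eq_sym -subr_eq0; apply/eqP; rewrite -(lim_eq cv); apply: lim_eq.
apply: (@cvg_of_bound _ _ (fun N => A * `|u| ^+ N)); last first.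
  rewrite -[X in _ --> X](mulr0 A); apply: cvgM; first exact: cvg_cst.
  by apply: cvg_expr; rewrite normr_id.
move=> N; rewrite subr0 !seriesEord /=.
have -> : \sum_(k < N) compose a w k * u ^+ k = \sum_(n < N) a n * \sum_(k < N) wpow w n k * u ^+ k.
  under eq_bigr do rewrite compose_widen// mulr_suml.
  rewrite exchange_big /=; apply: eq_bigr => n _; rewrite mulr_sumr.
  by apply: eq_bigr => k _; rewrite mulrA.
rewrite -sumrB; apply: le_trans (ler_norm_sum _ _ _) _.
apply: (@le_trans _ _ (\sum_(n < N) `|a n| * `|u| ^+ N)).
  apply: ler_sum => n _; rewrite -mulrBr normrM ler_wpM2l//.
  have := ps_tail N (asum_wpow n sw) u1'; rewrite (ps_wpow n sw u1) seriesEord /=.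
  move=> /le_trans; apply; rewrite ler_piMl ?exprn_ge0// exprn_ile1//.
by rewrite -mulr_suml ler_wpM2r// exprn_ge0.
Qed.

Lemma ps_geometric (l q u : R) : `|q * u| < 1 ->
  ps (fun n => if n is m.+1 then l * q ^+ m.+1 else 0) u = l * (q * u) / (1 - q * u).
Proof.
move=> qu; apply: lim_eq; rewrite -cvg_shiftS /=.
have -> : (fun n => series (fun n => (if n is m.+1 then l * q ^+ m.+1 else 0) * u ^+ n) n.+1) =
   series (geometric (l * (q * u)) (q * u)).
  apply: funext => n; rewrite !seriesEord /= big_ord_recl /= mul0r add0r.
  apply: eq_bigr => i _; by rewrite /bump /= add1n -mulrA -exprMn exprS add0n !mulrA.
exact: cvg_geometric_series.
Qed.

End composition.

(** * Local power series for the optimal cost and analyticity of the value *)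

Section analytic.
Context {R : realType} d1 d2 (T1 : measurableType d1) (T2 : measurableType d2).
Variables (mu : probability T1 R) (nu : probability T2 R) (c : T1 * T2 -> R).
Hypothesis bc : bm c.
Let q : probability (T1 * T2)%type R := (mu \x nu)%E.

Lemma scaled_value_series (s0 : R) : 0 < s0 -> exists r : R, [/\ 0 < r, r <= s0 &
  exists (C : nat -> R) (A : R), asum C A /\ forall h h', `|h| < 1 -> `|h'| < 1 ->
    (s0 + r * h') * rvalue mu nu c (s0 + r * h')^-1 <=
    (s0 + r * h) * rvalue mu nu c (s0 + r * h)^-1 + r * (h' - h) * ps C h].
Proof.
move=> s00; have [mc [M0 cM0]] := bc; pose M := `|M0| + 1.
have M1 : 0 < M by rewrite ltr_pwDr.
have cM z : `|c z| <= M.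
  by apply: le_trans (cM0 z) _; apply: le_trans (ler_norm _) _; rewrite lerDl.
pose K z := expR (- (s0 * c z)).
have bK : bm K by apply: bm_expR; apply: bmN; exact: bmZ.
pose m := expR (- (s0 * M)); pose M' := expR (s0 * M).
have m0 : 0 < m by exact: expR_gt0.
have mKM z : m <= K z <= M'.
  have := cM z; rewrite ler_norml => /andP[u v].
  by rewrite !ler_expR; apply/andP; split; nra.
have [a [b sch]] := schrodinger_exists mu nu bK m0 mKM.
pose eta := radius m M'; have eta0 : 0 < eta by rewrite radius_gt0// expR_gt0.
(* The perturbation factor is [e^(-r h c) - 1], with coefficients summing to at most [e^(r M) - 1];
   this is at most [eta] when [r M <= ln (1 + eta)]. The bound [r <= s0] keeps [s0 + r h] positive
   for [|h| < 1]. *)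
pose r := Num.min s0 (ln (1 + eta) / M).
have ln0 : 0 < ln (1 + eta) by rewrite ln_gt0// ltrDl.
have r0 : 0 < r by rewrite lt_min s00 divr_gt0.
have rM : expR (r * M) <= 1 + eta.
  rewrite -[leRHS]lnK ?posrE ?addr_gt0// ler_expR -ler_pdivlMr//.
  by rewrite ge_min lexx orbT.
exists r; split => //; first by rewrite ge_min lexx.
pose kap n z := if n is n'.+1 then exp_coeff (- (r * c z)) n else 0.
pose k n : R := if n is n'.+1 then exp_coeff (r * M) n else 0.
have bexp n : bm (fun z => exp_coeff (- (r * c z)) n).
  rewrite /exp_coeff /=; under eq_fun do rewrite mulrC; apply: bmZ.
  elim: n => [|n IH]; first exact: bm_cst.
  under eq_fun do rewrite exprS; apply: bmM => //; apply: bmN; exact: bmZ.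
have bkap n : bm (kap n) by case: n => [|n]; [exact: bm_cst|exact: bexp].
have kapk n z : `|kap n z| <= k n.
  case: n => [|n]; first by rewrite normr0.
  rewrite /kap /k /exp_coeff /= normrM [X in _ * X]ger0_norm ?invr_ge0// ler_wpM2r ?invr_ge0//.
  rewrite normrX normrN normrM (gtr0_norm r0) lerXn2r ?nnegrE ?mulr_ge0 ?(ltW r0) ?(ltW M1)//.
  by rewrite ler_wpM2l// ltW.
have rM0 : 0 <= r * M by rewrite mulr_ge0// ltW.
have sk : asum k eta.
  case=> [|N]; first by rewrite big_ord0 ltW.
  rewrite big_ord_recl normr0 add0r.
  have e0 : 1 + \sum_(i < N) `|k (bump 0 i)| = series (exp_coeff (r * M)) N.+1.
    have ec0 : exp_coeff (r * M) 0 = 1 by rewrite /exp_coeff /= expr0 fact0 divr1.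
    rewrite seriesEord /= big_ord_recl /= ec0; congr (_ + _).
    apply: eq_bigr => i _; rewrite /bump /= ger0_norm//.
    by rewrite exp_coeff_ge0.
  rewrite -(lerD2l 1) e0; apply: le_trans rM; rewrite /expR.
  apply: nondecreasing_cvgn_le; last exact: is_cvg_series_exp_coeff.
  by apply: nondecreasing_series => n _ _; exact: exp_coeff_ge0.
have [al [be [A [bal bbe alA beA [sA sol]]]]] :=
  schrodinger_perturb bK m0 mKM sch bkap kapk erefl sk.
have Kh h z : `|h| <= 1 -> K z * (1 + ps (kap^~ z) h) = expR (- ((s0 + r * h) * c z)).
  move=> h1; rewrite mulrDl opprD expRD; congr (_ * _).
  have skz : asum (kap^~ z) eta.
    by apply: le_asum sk => n; apply: le_trans (kapk n z) _; exact: ler_norm.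
  rewrite -(ps_hat skz h1) /expR; congr (limn (series _)); apply: funext => n.
  case: n => [|n]; rewrite /hat /kap /one_seq /exp_coeff /=.
    by rewrite addr0 !expr0 mulr1 fact0 divr1.
  by rewrite add0r mulrAC -exprMn; congr (_ ^+ _ / _); ring.
pose p0 := gibbs K a b.
have [[ba _] [bb _] _ _] := sch.
have bp0 : bm p0 by exact: bm_gibbs.
(* Coefficients in [h] of the ratio between the optimal density at [s0 + r h] and [p0]; integrating
   against [c * p0] gives those of the optimal cost. *)
pose cf z := conv (hat (al^~ z.1)) (conv (hat (kap^~ z)) (hat (be^~ z.2))).
have bcf n : bm (fun z => c z * p0 z * cf z n).
  apply: bmM; first exact: bmM.
  apply: bm_sum => i; apply: bmM.
    exact: (@bm_fst R _ _ T1 T2 _ (bm_hat i bal)).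
  apply: bm_sum => j; apply: bmM; first exact: bm_hat.
  exact: (@bm_snd R _ _ T1 T2 _ (bm_hat _ bbe)).
have [_ [Q cQ]] := bmM bc bp0.
have Q0 : 0 <= Q by apply: le_trans (cQ point).
have sal x : asum (al^~ x) 2^-1.
  by apply: le_asum sA => n; apply: le_trans (alA n x) _; exact: ler_norm.
have sbe y : asum (be^~ y) 2^-1.
  by apply: le_asum sA => n; apply: le_trans (beA n y) _; exact: ler_norm.
have skp z : asum (kap^~ z) eta.
  by apply: le_asum sk => n; apply: le_trans (kapk n z) _; exact: ler_norm.
pose D n := conv (hat A) (conv (hat k) (hat A)) n.
have sD : asum D ((1 + 2^-1) * ((1 + eta) * (1 + 2^-1))).
  by apply: asum_conv; [exact: asum_hat|apply: asum_conv; exact: asum_hat].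
have cfD n z : `|c z * p0 z * cf z n| <= Q * D n.
  rewrite normrM ler_pM//; apply: le_conv => i; first exact: le_hat.
  by apply: le_conv => j; exact: le_hat.
have sQD := asumZ Q0 sD.
pose C n := E q (fun z => c z * p0 z * cf z n).
exists C, (Q * ((1 + 2^-1) * ((1 + eta) * (1 + 2^-1)))); split.
  apply: le_asum sQD => n; apply: le_trans (ler_norm _).
  by apply: E_norm => // z.
have pos h : `|h| < 1 -> 0 < s0 + r * h.
  move=> h1; have rs : r <= s0 by rewrite ge_min lexx.
  have /andP[u _] : - 1 < h < 1 by rewrite -ltr_norml.
  nra.
move=> h h' h1 h'1; have h1' := ltW h1.
have := sol h h1; rewrite (_ : (fun z => K z * _) = fun z => expR (- ((s0 + r * h) * c z))); last first.
  by apply: funext => z; exact: Kh.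
move=> solh; have [e1 e2] := rvalue_schrodinger bc (pos _ h1) solh.
have := e2 _ (pos _ h'1); rewrite -e1 => /le_trans; apply; rewrite lerD2l.
have -> : s0 + r * h' - (s0 + r * h) = r * (h' - h) by ring.
suff -> : ps C h = E q (fun z => c z * gibbs (fun z => expR (- ((s0 + r * h) * c z)))
  (fun x => a x * (1 + ps (al^~ x) h)) (fun y => b y * (1 + ps (be^~ y) h)) z) by [].
rewrite /C -(E_ps q bcf cfD sQD h1'); congr E; apply: funext => z.
have skb := asum_conv (asum_hat (skp z)) (asum_hat (sbe z.2)).
rewrite (psZ _ (asum_conv (asum_hat (sal z.1)) skb) h1').
rewrite (ps_conv (asum_hat (sal z.1)) skb h1) (ps_conv (asum_hat (skp z)) (asum_hat (sbe z.2)) h1).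
rewrite (ps_hat (sal z.1) h1') (ps_hat (sbe z.2) h1') (ps_hat (skp z) h1').
by rewrite /gibbs -(Kh _ z h1') /p0 /gibbs; ring.
Qed.

Lemma rvalue_analytic : analytic_on (rvalue mu nu c) [set eps : R | 0 < eps].
Proof.
move=> e0 /= e00; pose s0 := e0^-1; have s00 : 0 < s0 by rewrite invr_gt0.
have [r [r0 rs0 [C [A [sC sup]]]]] := scaled_value_series s00.
pose F h := (s0 + r * h) * rvalue mu nu c (s0 + r * h)^-1.
have FE := antiderivative (f := F) (ltW r0) sC sup.
have sF := asum_antider (F 0) (ltW r0) sC; set a := antider _ _ _ in FE sF.
have d0 : 0 < 2 * s0 + r by rewrite addr_gt0// mulr_gt0.
(* Chosen so that the coefficients of [w] below sum in absolute value to
   [(s0 / r) * lam / (1 - lam) = 1/2], the radius on which [F] is known as a series. *)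
have [lam lamE] : exists lam : R, lam = r / (2 * s0 + r) by eexists.
have lam0 : 0 < lam by rewrite lamE divr_gt0.
have lam1 : lam < 1 by rewrite lamE ltr_pdivrMr// mul1r ltrDr mulr_gt0.
(* Expansion of [h] in [u], where [eps = e0 (1 + lam u)]: the relation [s0 + r h = 1 / eps] gives
   [h = - (s0 / r) * lam u / (1 + lam u)]. *)
pose w n := if n is m.+1 then s0 / r * (- lam) ^+ m.+1 else 0.
have sw : asum w 2^-1.
  have sg : asum (fun n => s0 / r * lam * lam ^+ n) 2^-1.
    have -> : 2^-1 = s0 / r * lam * (1 - lam)^-1.
      rewrite lamE; field; rewrite !gt_eqF//= -?addrA ?subrr ?addr0 ?mulr_gt0//.
    apply: asum_geometric; last by rewrite ltW.
    by rewrite !mulr_ge0 ?invr_ge0 ?ltW.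
  case=> [|N]; first by rewrite big_ord0.
  rewrite big_ord_recl normr0 add0r; apply: le_trans (sg N); apply: ler_sum => i _.
  by rewrite /bump /= exprS mulrA !normrM !normrX normrN add0n.
have w0 : w 0%N = 0 by [].
have half1 : (2^-1 : R) <= 1 by lra.
have se := asum_compose sF sw half1 w0.
pose d n : R := if n == 0%N then e0 else if n == 1%N then e0 * lam else 0.
have sd : asum d (e0 + e0 * lam).
  move=> [|[|N]]; rewrite ?big_ord_recl ?big_ord0 /= ?addr0.
  - by rewrite addr_ge0// ?mulr_ge0// ltW.
  - by rewrite gtr0_norm// lerDl mulr_ge0// ltW.
  - rewrite big1 ?addr0; last by move=> i _; rewrite normr0.
    by rewrite !gtr0_norm// mulr_gt0.
have psd u : ps d u = e0 + e0 * lam * u.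
  apply: lim_eq; rewrite -(cvg_shiftn 2) /=.
  have -> : (fun n => series (fun n => d n * u ^+ n) (n + 2)%N) = fun=> e0 + e0 * lam * u.
    apply: funext => n; rewrite seriesEord /= addn2 !big_ord_recl /= big1 ?addr0.
      by rewrite /d /= expr0 mulr1 expr1.
    by move=> i _; rewrite mul0r.
  exact: cvg_cst.
(* The value is [eps * F(w(u))], because [F] carries the factor [1 / eps]; [d] is the series of
   [eps] in [u]. *)
pose e := conv d (compose a w).
have r00 : 0 < e0 * lam by rewrite mulr_gt0.
exists (e0 * lam); split => //.
exists (fun n => e n / (e0 * lam) ^+ n) => x xr.
pose u := (x - e0) / (e0 * lam).
have u1 : `|u| < 1 by rewrite normrM normfV [X in _ / X]gtr0_norm// ltr_pdivrMr// mul1r.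
have xE : x = e0 + e0 * lam * u by rewrite /u mulrC divfK ?gt_eqF// subrKC.
have -> : (fun n => e n / (e0 * lam) ^+ n * (x - e0) ^+ n) = fun n => e n * u ^+ n.
  by apply: funext => n; rewrite /u expr_div_n -mulrA; congr (_ * _); rewrite mulrC.
have lu : `|(- lam) * u| < 1.
  rewrite normrM normrN (gtr0_norm lam0); apply: le_lt_trans lam1.
  by rewrite ler_piMr// ltW.
have lu1 : 0 < 1 + lam * u.
  by have := lu; rewrite mulNr normrN ltr_norml => /andP[+ _]; rewrite -subr_gt0 opprK addrC.
have x0 : 0 < x by rewrite xE -mulrA -[X in X + _]mulr1 -mulrDr mulr_gt0.
suff <- : ps e u = rvalue mu nu c x.
  by apply: ps_cvg (ltW u1); exact: (asum_conv sd se).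
rewrite (ps_conv sd se u1) psd -xE (ps_compose sF sw half1 w0 u1).
have wu : ps w u = s0 / r * (- lam * u) / (1 - (- lam * u)) by exact: ps_geometric.
have sx : s0 + r * ps w u = x^-1.
  rewrite wu xE /s0; field; rewrite !gt_eqF//=.
    by rewrite mulNr opprK.
  by rewrite -mulrA -[X in X + _]mulr1 -mulrDr mulr_gt0.
rewrite -FE; last by apply: ps_le sw (ltW u1).
by rewrite /F sx invrK mulrA mulfV ?gt_eqF// mul1r.
Qed.

End analytic.

(** * Block approximation and continuity *)

Section cells.
Context {R : realType} d (T : measurableType d) (I : finType) (cell : T -> I).
Hypothesis mcell : forall i, measurable (cell @^-1` [set i]).

Definition in_cell i (x : T) : R := (cell x == i)%:R.

Lemma bm_in_cell i : bm (in_cell i).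
Proof.
have -> : in_cell i = \1_(cell @^-1` [set i]).
  apply: funext => x; rewrite indicE /in_cell.
  suff -> : (x \in cell @^-1` [set i]) = (cell x == i) by [].
  by apply/idP/eqP; rewrite inE.
split; first exact: measurable_indic.
by exists 1 => x; rewrite indicE; case: (_ \in _); rewrite ?normr1 ?normr0.
Qed.

Lemma cellE (F : I -> R) x : F (cell x) = \sum_i F i * in_cell i x.
Proof.
rewrite (bigD1 (cell x)) //= /in_cell eqxx mulr1 big1 ?addr0// => i ne.
by rewrite eq_sym (negbTE ne) mulr0.
Qed.

Lemma sum_in_cell x : \sum_i in_cell i x = 1.
Proof. by rewrite (cellE (fun=> 1) x); apply: eq_bigr => i _; rewrite mul1r. Qed.

Lemma bm_cell (F : I -> R) : bm (fun x => F (cell x)).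
Proof.
have -> : (fun x => F (cell x)) = fun x => \sum_i F i * in_cell i x.
  by apply: funext => x; exact: cellE.
by apply: bm_sum => i; apply: bmZ; exact: bm_in_cell.
Qed.

Lemma E_cell (m : probability T R) (F : I -> R) :
  E m (fun x => F (cell x)) = \sum_i F i * E m (in_cell i).
Proof.
have -> : (fun x => F (cell x)) = fun x => \sum_i F i * in_cell i x.
  by apply: funext => x; exact: cellE.
rewrite E_sum; last by move=> i; apply: bmZ; exact: bm_in_cell.
by apply: eq_bigr => i _; rewrite EZ//; exact: bm_in_cell.
Qed.

Lemma E_in_cell_ge0 (m : probability T R) i : 0 <= E m (in_cell i).
Proof. by apply: E_ge0 => x; rewrite ler0n. Qed.

(** The discarded part is dominated by a multiple of the indicator of the null cells, which
    integrates to zero. *)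
Lemma null_cells (m : probability T R) f : bm f ->
  E m (fun x => f x * (E m (in_cell (cell x)) != 0)%:R) = E m f.
Proof.
move=> bf; have [_ [M fM]] := bf.
pose w i : R := (E m (in_cell i) == 0)%:R; pose w' i : R := (E m (in_cell i) != 0)%:R.
have bfw : bm (fun x => f x * w (cell x)) by apply: bmM => //; exact: bm_cell.
have bfw' : bm (fun x => f x * w' (cell x)) by apply: bmM => //; exact: bm_cell.
suff h : E m (fun x => f x * w (cell x)) = 0.
  rewrite -[RHS](_ : E m (fun x => f x * w' (cell x) + f x * w (cell x)) = _).
    by rewrite ED// h addr0.
  by congr E; apply: funext => x; rewrite /w /w'; case: eqP => _; rewrite ?mulr1 ?mulr0 ?addr0 ?add0r.
apply/eqP; rewrite -normr_le0.
have -> : 0 = E m (fun x => M * w (cell x)).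
  rewrite (E_cell m (fun i => M * w i)) big1// => i _; rewrite /w.
  by case: eqP => [->|_]; rewrite mulr0 ?mul0r.
apply: E_norm_le => //; first by apply: bmZ; exact: bm_cell.
move=> x; rewrite normrM [X in _ * X]ger0_norm ?ler0n// ler_wpM2r ?ler0n//.
Qed.

End cells.

Section blocks.
Context {R : realType} d1 d2 (T1 : measurableType d1) (T2 : measurableType d2).
Variables (mu : probability T1 R) (nu : probability T2 R) (c : T1 * T2 -> R).
Variables (I J : finType) (cell1 : T1 -> I) (cell2 : T2 -> J).
Hypothesis mcell1 : forall i, measurable (cell1 @^-1` [set i]).
Hypothesis mcell2 : forall j, measurable (cell2 @^-1` [set j]).
Let q : probability (T1 * T2)%type R := (mu \x nu)%E.
Variable g : probability (T1 * T2)%type R.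
Hypothesis mg : marginals mu nu g.

Let cell (z : T1 * T2) := (cell1 z.1, cell2 z.2).

Let mcell ij : measurable (cell @^-1` [set ij]).
Proof.
have -> : cell @^-1` [set ij] = (cell1 @^-1` [set ij.1]) `*` (cell2 @^-1` [set ij.2]).
  by case: ij => i j; apply/seteqP; split=> -[x y] /=; [move=> [<- <-]|move=> [<- <-]].
exact: measurableX.
Qed.

Let m1 i := E mu (in_cell (R := R) cell1 i).
Let m2 j := E nu (in_cell (R := R) cell2 j).
Let G ij := E g (in_cell (R := R) cell ij).

Let in_cellM i j z : in_cell cell (i, j) z = in_cell cell1 i z.1 * in_cell cell2 j z.2 :> R.
Proof. by rewrite /in_cell /cell xpair_eqE -natrM mulnb. Qed.

Let b1 i := bm_in_cell (R := R) mcell1 i.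
Let b2 j := bm_in_cell (R := R) mcell2 j.
Let bG ij := bm_in_cell (R := R) mcell ij.

Let G_row i : \sum_j G (i, j) = m1 i.
Proof.
rewrite /m1 -(marginals_fst mg (b1 i)) /G -E_sum; last by move=> j; exact: bG.
congr E; apply: funext => z; under eq_bigr do rewrite in_cellM.
by rewrite -mulr_sumr sum_in_cell mulr1.
Qed.

Let G_col j : \sum_i G (i, j) = m2 j.
Proof.
rewrite /m2 -(marginals_snd mg (b2 j)) /G -E_sum; last by move=> i; exact: bG.
congr E; apply: funext => z; under eq_bigr do rewrite in_cellM.
by rewrite -mulr_suml sum_in_cell mul1r.
Qed.

Let G_ge0 ij : 0 <= G ij. Proof. exact: E_in_cell_ge0. Qed.

Let G_row0 i j : m1 i = 0 -> G (i, j) = 0.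
Proof.
move=> m10; apply/eqP; rewrite eq_le G_ge0 andbT -m10 -G_row (bigD1 j)//= lerDl.
by apply: sumr_ge0.
Qed.

Let G_col0 i j : m2 j = 0 -> G (i, j) = 0.
Proof.
move=> m20; apply/eqP; rewrite eq_le G_ge0 andbT -m20 -G_col (bigD1 i)//= lerDl.
by apply: sumr_ge0.
Qed.

(* Mass [G ij] spread as a product measure over each block; a null block gets the value [x / 0 = 0]. *)
Let W ij := G ij / (m1 ij.1 * m2 ij.2).
Let p z := W (cell z).

Let W1 i : \sum_j W (i, j) * m2 j = (m1 i != 0)%:R.
Proof.
have [m0|m0] := eqVneq (m1 i) 0.
  by rewrite big1// => j _; rewrite /W /= G_row0// !mul0r.
rewrite -[RHS](mulfV m0) -{1}G_row mulr_suml; apply: eq_bigr => j _; rewrite /W /=.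
by have [m20|m20] := eqVneq (m2 j) 0; [rewrite G_col0// !mul0r|field; rewrite m0 m20].
Qed.

Let W2 j : \sum_i W (i, j) * m1 i = (m2 j != 0)%:R.
Proof.
have [m0|m0] := eqVneq (m2 j) 0.
  by rewrite big1// => i _; rewrite /W /= G_col0// !mul0r.
rewrite -[RHS](mulfV m0) -{1}G_col mulr_suml; apply: eq_bigr => i _; rewrite /W /=.
by have [m10|m10] := eqVneq (m1 i) 0; [rewrite G_row0// !mul0r|field; rewrite m0 m10].
Qed.

Let bp : bm p. Proof. exact: bm_cell. Qed.

Let q_cell i j : E q (in_cell cell (i, j)) = m1 i * m2 j.
Proof.
rewrite -(fubini12 mu nu (bG (i, j))) [RHS]mulrC -EZ//; congr E; apply: funext => x.
under eq_fun do rewrite in_cellM /=.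
by rewrite EZ// mulrC.
Qed.

(** The new coupling gives each product cell the same mass as [g], so both integrate the step
    function [S] equally. Exchanging [c] for [S] and back costs [e] each time. *)
Lemma block_approximation (S : I -> J -> R) e :
  bm c -> (forall z, `|c z - S (cell1 z.1) (cell2 z.2)| <= e) ->
  exists g' H, [/\ marginals mu nu g', Ent g' q = H%:E & E g' c <= E g c + 2 * e].
Proof.
move=> bc cS.
have p0 z : 0 <= p z by rewrite /p /W divr_ge0// mulr_ge0// E_in_cell_ge0.
have p1 f : bm f -> E q (fun z => f z.1 * p z) = E mu f.
  move=> bf; rewrite -(null_cells mcell1 mu bf).
  have bfp : bm (fun z => f z.1 * p z) by apply: bmM => //; exact: (@bm_fst R _ _ T1 T2 _ bf).
  rewrite -(fubini12 mu nu bfp); congr E; apply: funext => x /=.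
  rewrite EZ; last exact: (@bm_sec1 R _ _ T1 T2 p x bp).
  by congr (_ * _); rewrite (E_cell mcell2 nu (fun j => W (cell1 x, j))) W1.
have p2 f : bm f -> E q (fun z => f z.2 * p z) = E nu f.
  move=> bf; rewrite -(null_cells mcell2 nu bf).
  have bfp : bm (fun z => f z.2 * p z) by apply: bmM => //; exact: (@bm_snd R _ _ T1 T2 _ bf).
  rewrite -(fubini21 mu nu bfp); congr E; apply: funext => y /=.
  rewrite EZ; last exact: (@bm_sec2 R _ _ T1 T2 p y bp).
  by congr (_ * _); rewrite (E_cell mcell1 mu (fun i => W (i, cell2 y))) W2.
have [g' mg' dg'] := density_marginals bp p0 p1 p2.
exists g', (E q (fun z => p z * ln (p z))); split => //; first exact: Ent_bm.
pose S' ij := S ij.1 ij.2.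
have bS : bm (fun z => S' (cell z)) by exact: bm_cell.
have e1 : E g' (fun z => S' (cell z)) = E g (fun z => S' (cell z)).
  rewrite (density_E dg' bS) (E_cell mcell q (fun ij => S' ij * W ij)) (E_cell mcell g S').
  apply: eq_bigr => -[i j] _; rewrite -mulrA; congr (_ * _); rewrite q_cell /W /=.
  have [m0|m0] := eqVneq (m1 i) 0; first by rewrite -/(G (i, j)) G_row0// !mul0r.
  have [m20|m20] := eqVneq (m2 j) 0; first by rewrite -/(G (i, j)) G_col0// !mul0r.
  by rewrite divfK// mulf_neq0.
have h1 : E g' c <= E g' (fun z => S' (cell z)) + e.
  rewrite -(E_cst g' e) -ED//; last exact: bm_cst.
  apply: le_E => //; first by apply: bmD => //; exact: bm_cst.
  by move=> z; have := cS z; rewrite ler_norml /S' /= => /andP[]; lra.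
have h2 : E g (fun z => S' (cell z)) <= E g c + e.
  rewrite -(E_cst g e) -ED//; last exact: bm_cst.
  apply: le_E => //; first by apply: bmD => //; exact: bm_cst.
  by move=> z; have := cS z; rewrite ler_norml /S' /= => /andP[]; lra.
lra.
Qed.

End blocks.

(** * Continuity on the half-line and at zero *)

Section continuity.
Context {R : realType}.

(** At [0], monotonicity and the assumed right bound suffice. At [x > 0], concavity along the chord
    from [0] limits the increase to the right of any positive point, and monotonicity supplies the
    other side. *)
Lemma concave_continuous (f : R -> R) :
  nondecreasing_on f [set x : R | 0 <= x] -> concave_on f [set x : R | 0 <= x] ->
  (forall e : R, 0 < e -> exists2 r : R, 0 < r & forall x, 0 <= x < r -> f x <= f 0 + e) ->
  {within [set x : R | 0 <= x], continuous f}.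
Proof.
move=> nd cc right0; apply/subspace_continuousP => x /= x0; apply/cvgrPdist_le => e e0.
rewrite /from_subspace near_withinE; apply/nbhs_ballP.
move: x0; rewrite le_eqVlt => /predU1P[<-|x0].
  have [r r0 fr] := right0 e e0; exists r => // y; rewrite /ball /= sub0r normrN => yr y0.
  rewrite (ger0_norm y0) in yr.
  have u1 := nd 0 y (lexx 0) y0 y0; have u2 := fr y; rewrite y0 yr in u2.
  by rewrite ler_norml; apply/andP; have := u2 isT; split; lra.
pose D := f x - f 0.
have D0 : 0 <= D by rewrite subr_ge0; apply: nd => //=; exact: ltW.
have chord (s t : R) : 0 < s -> s <= t -> f t - f s <= (t - s) / s * (f s - f 0).
  move=> s0 st; have t0 : 0 < t by exact: lt_le_trans st.
  have st01 : 0 <= s / t <= 1 by rewrite divr_ge0 ?(ltW s0) ?(ltW t0)//= ler_pdivrMr// mul1r.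
  have := cc 0 t (s / t) (lexx 0) (ltW t0) st01; rewrite mulr0 add0r divfK ?gt_eqF// => h.
  have h2 : s / t * (f t - f 0) <= f s - f 0 by lra.
  rewrite -(ler_pM2l (divr_gt0 t0 s0)) mulrA in h2.
  have e1 : t / s * (s / t) = 1 by field; rewrite !gt_eqF.
  have e2 : t / s = (t - s) / s + 1 by field; rewrite gt_eqF.
  rewrite e1 mul1r e2 in h2; lra.
(* Staying above [x / 2] bounds [1 / y] by [2 / x] when [y < x]; [D + 1] instead of [D] avoids
   dividing by zero. *)
exists (Num.min (x / 2) (e * x / (2 * (D + 1)))) => /=.
  by rewrite lt_min !divr_gt0 ?mulr_gt0// ltr_wpDl.
move=> y; rewrite /ball /= lt_min => /andP[yx ye] y0.
have x2y : x / 2 <= y by move: yx; rewrite ltr_norml => /andP[]; lra.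
have y0' : 0 < y by apply: lt_le_trans x2y; rewrite divr_gt0.
have bound : `|x - y| * 2 / x * D <= e.
  have h1 : `|x - y| * (2 * (D + 1)) <= e * x.
    by rewrite -ler_pdivlMr ?mulr_gt0 ?ltr_wpDl// ltW.
  rewrite mulrAC ler_pdivrMr//; apply: le_trans h1; rewrite -mulrA ler_wpM2l//; lra.
have [xy|yx'] := leP x y.
  have u1 := chord x y x0 xy; have u2 := nd x y (ltW x0) y0 xy.
  have u3 : (y - x) / x * D <= `|x - y| * 2 / x * D.
    rewrite ler_wpM2r// ler_wpM2r ?invr_ge0 ?(ltW x0)// distrC ger0_norm ?subr_ge0//; lra.
  rewrite ler_norml /D in bound u3 *; apply/andP; split; lra.
have u1 := chord y x y0' (ltW yx'); have u2 := nd y x y0 (ltW x0) (ltW yx').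
have u3 : (x - y) / y * (f y - f 0) <= `|x - y| * 2 / x * D.
  rewrite ger0_norm ?subr_ge0 ?(ltW yx')//; apply: ler_pM.
  - by rewrite divr_ge0 ?subr_ge0 ?(ltW yx').
  - by rewrite subr_ge0; apply: nd => //=.
  - rewrite -mulrA ler_wpM2l ?subr_ge0 ?(ltW yx')// -(invrK 2) -invfM lef_pV2 ?posrE ?divr_gt0//.
      by rewrite mulrC.
    by rewrite mulr_gt0 ?invr_gt0.
  - by rewrite /D lerD2r.
rewrite ler_norml; apply/andP; split; lra.
Qed.

End continuity.

Section right_continuity.
Context {R : realType} d1 d2 (T1 : measurableType d1) (T2 : measurableType d2).
Variables (mu : probability T1 R) (nu : probability T2 R) (c : T1 * T2 -> R).
Hypothesis bc : bm c.

(** The form in which continuity of the cost enters the measure-theoretic part. Cells are products,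
    so a block density factors through the two marginals. *)
Definition step_approximable := forall e : R, 0 < e ->
  exists (I J : finType) (cell1 : T1 -> I) (cell2 : T2 -> J) (S : I -> J -> R),
  [/\ forall i, measurable (cell1 @^-1` [set i]), forall j, measurable (cell2 @^-1` [set j]) &
      forall z, `|c z - S (cell1 z.1) (cell2 z.2)| <= e].

Lemma rvalue_right0 : step_approximable -> forall e : R, 0 < e ->
  exists2 r : R, 0 < r & forall x, 0 <= x < r -> rvalue mu nu c x <= rvalue mu nu c 0 + e.
Proof.
move=> step e e0.
have [g mg gc] : exists2 g, marginals mu nu g & E g c <= rvalue mu nu c 0 + e / 4.
  apply: contrapT => h; suff : rvalue mu nu c 0 + e / 4 <= rvalue mu nu c 0 by lra.
  apply: rvalue0_ge => // g mg; rewrite leNgt; apply/negP => lt.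
  by apply: h; exists g => //; exact: ltW.
(* Budget: [e / 4] for near-optimality at [0], [2 * (e / 8)] for the block replacement, and at most
   [e / 4] for [x * H]. *)
have e8 : 0 < e / 8 by rewrite divr_gt0.
have [I [J [cell1 [cell2 [S [mc1 mc2 cS]]]]]] := step _ e8.
have [g' [H [mg' gH cg']]] := block_approximation mc1 mc2 mg bc cS.
have H0 := Ent_fin_ge0 gH.
exists (e / (4 * (H + 1))); first by rewrite divr_gt0// mulr_gt0// ltr_wpDl.
move=> x /andP[x0 xr]; apply: le_trans (rvalue_le bc x0 mg' gH) _.
have h : x * (4 * (H + 1)) <= e by rewrite -ler_pdivlMr ?ltW// mulr_gt0// ltr_wpDl.
nra.
Qed.

End right_continuity.

(** * Compactly supported costs *)

Section compact_cells.
Context {R : realType} (d : nat).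
Implicit Types (X : set 'rV[R]_d).

Lemma finite_ball_cover X (r : R) : compact X -> 0 < r ->
  exists s : seq 'rV[R]_d, (forall y, y \in s -> X y) /\
    forall x, X x -> exists2 y, y \in s & ball y r x.
Proof.
move=> cX r0; rewrite compact_cover in cX.
have [| |D DX XD] := cX 'rV[R]_d X (fun y => (ball y r)°).
- by move=> y _; exact: open_interior.
- by move=> x Xx; exists x => //; exact: nbhsx_ballx.
exists D; split=> [y yD|x Xx]; first by have := DX y yD; rewrite inE.
by have [y yD /interior_subset yx] := XD x Xx; exists y.
Qed.

(** Balls of row vectors are balls of the max norm, hence finite intersections of coordinate
    slabs. *)
Lemma measurable_ball_row (y : 'rV[R]_d) (r : R) :
  measurable (@toRow R d @^-1` ball y r).
Proof.
have [r0|r0] := ltP 0 r; last first.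
  rewrite (_ : _ @^-1` _ = set0) //; apply/seteqP; split=> x //= -[+ _].
  by rewrite ltNge r0.
have -> : @toRow R d @^-1` ball y r =
    \big[setI/setT]_(i < d) [set x : d.-tuple R | `|y ord0 i - tnth x i| < r].
  apply/seteqP; split=> x /=.
    move=> [_ h]; rewrite -bigcap_seq /= => i _ /=.
    by have := h ord0 i; rewrite /ball /= mxE.
  rewrite -bigcap_seq /= => h; split => // i j; rewrite ord1 /ball /= mxE.
  by apply: (h j) => /=; exact: mem_index_enum.
apply: bigsetI_measurable => i _.
have mf : measurable_fun setT (fun x : d.-tuple R => `|y ord0 i - tnth x i|).
  apply: measurableT_comp => //; apply: measurable_funB => //; exact: measurable_tnth.
rewrite -[X in measurable X]setTI.
have -> : [set x : d.-tuple R | `|y ord0 i - tnth x i| < r] =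
  (fun x : d.-tuple R => `|y ord0 i - tnth x i|) @^-1` `]-oo, r[%classic.
  by apply/seteqP; split=> x /=; rewrite in_itv.
exact: mf.
Qed.

(** A compact set is the intersection over [n] of finite unions of balls of radius [1 / (n + 1)]
    centred in it; closedness gives the nontrivial inclusion. *)
Lemma measurable_compact_row X : compact X -> measurable (@toRow R d @^-1` X).
Proof.
move=> cX; have clX : closed X by exact: compact_closed.
have n0 n : 0 < n.+1%:R^-1 :> R by rewrite invr_gt0.
pose s n := projT1 (cid (finite_ball_cover cX (n0 n))).
have sP n : (forall y, y \in s n -> X y) /\
    forall x, X x -> exists2 y, y \in s n & ball y n.+1%:R^-1 x.
  exact: projT2 (cid (finite_ball_cover cX (n0 n))).
have -> : @toRow R d @^-1` X = \bigcap_n \big[setU/set0]_(y <- s n) (@toRow R d @^-1` ball y n.+1%:R^-1).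
  apply/seteqP; split=> x /= h.
    move=> n _; have [y ys yx] := (sP n).2 _ h.
    by rewrite -bigcup_seq; exists y.
  rewrite (closure_id X).1//.
  move=> B /nbhs_ballP[e /= e0 Be].
  have [n ne] : exists n, n.+1%:R^-1 < e.
    exists (Num.truncn e^-1); rewrite -[ltRHS]invrK ltf_pV2 ?posrE ?invr_gt0//.
    exact: truncnS_gt.
  have := h n I; rewrite -bigcup_seq => -[y ys yx].
  exists y; split; first exact: (sP n).1.
  apply: Be; apply: ball_sym; apply: le_ball yx; exact: ltW.
apply: bigcapT_measurable => n; apply: bigsetU_measurable => y _.
exact: measurable_ball_row.
Qed.

End compact_cells.

Section partition.
Context d (T : measurableType d) (B : seq (set T)).

(** The atom of the finite algebra generated by [B], encoded by its membership vector so that the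
    atoms are indexed by a [finType]. *)
Definition atom (x : T) : {ffun 'I_(size B) -> bool} :=
  [ffun k => `[< nth set0 B (k : 'I_(size B)) x >]].

Lemma measurable_atom v : (forall k, (k < size B)%N -> measurable (nth set0 B k)) ->
  measurable (atom @^-1` [set v]).
Proof.
move=> mB.
have -> : atom @^-1` [set v] = \big[setI/setT]_(k < size B)
    (if v k then nth set0 B k else ~` nth set0 B k).
  apply/seteqP; split=> x /=.
    move=> <-; rewrite -bigcap_seq /= => k _; rewrite /atom ffunE.
    by case: asboolP.
  rewrite -bigcap_seq /= => h; apply/ffunP => k; rewrite ffunE.
  have := h k (mem_index_enum k); rewrite /=; case: (v k) => /= hk; [exact/asboolP|exact/asboolPn].
by apply: bigsetI_measurable => k _; case: (v k); [|apply: measurableC]; exact: mB.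
Qed.

Lemma atom_eq x x' k : atom x = atom x' -> (k < size B)%N ->
  nth set0 B k x -> nth set0 B k x'.
Proof.
move=> e kB; have := congr1 (fun f : {ffun 'I_(size B) -> bool} => f (Ordinal kB)) e.
by rewrite !ffunE /= => h /asboolP; rewrite h => /asboolP.
Qed.

End partition.

Section cost_approximation.
Context {R : realType} (d : nat).
Variables (Xm Xp : set 'rV[R]_d) (c : 'rV[R]_d * 'rV[R]_d -> R).
Hypothesis cXm : compact Xm.
Hypothesis cXp : compact Xp.
Hypothesis cc : {within Xm `*` Xp, continuous c}.

(** Near-covering form of compactness: around [z] with continuity radius [rho] for [e / 2], points
    within [rho / 2] and radii below [rho / 2] work together. *)
Lemma heine (e : R) : 0 < e -> exists2 r : R, 0 < r & forall z z',
  (Xm `*` Xp) z -> (Xm `*` Xp) z' -> ball z r z' -> `|c z - c z'| <= e.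
Proof.
move=> e0; have cK : compact (Xm `*` Xp) by exact: compact_setX.
pose P (n : nat) z := forall z', (Xm `*` Xp) z' -> ball z n.+1%:R^-1 z' -> `|c z - c z'| <= e.
have : \forall n \near \oo, (Xm `*` Xp) `<=` P n.
  apply: (near_covering_withinP _).2 => //; first exact/compact_near_coveringP.
  move=> z Kz; have e20 : 0 < e / 2 by rewrite divr_gt0.
  have := (subspace_continuousP _ _).1 cc z Kz; move=> /cvgrPdist_le /(_ _ e20).
  rewrite near_withinE => /nbhs_ballP[rho /= rho0 hrho].
  exists (ball z (rho / 2), [set n | n.+1%:R^-1 < rho / 2]) => /=.
    split; first by apply: nbhsx_ballx; rewrite divr_gt0.
    exists (Num.truncn (rho / 2)^-1) => // n /= hn.
    rewrite -[ltRHS]invrK ltf_pV2 ?posrE ?invr_gt0 ?divr_gt0//.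
    apply: (lt_le_trans (truncnS_gt _)); by rewrite ler_nat ltnS.
  move=> [z' n] /= [zz' nr] Kz' z'' Kz'' z'z''.
  have rr : rho / 2 <= rho by rewrite ler_pdivrMr// ler_peMr ?ltW//; lra.
  have h1' : `|c z - c z'| <= e / 2 by apply: (hrho z' _ Kz'); exact: le_ball zz'.
  have h2' : `|c z - c z''| <= e / 2.
    apply: (hrho z'' _ Kz''); rewrite [rho]splitr; apply: ball_triangle zz' _.
    by apply: le_ball z'z''; exact: ltW.
  rewrite (_ : c z' - c z'' = (c z - c z'') - (c z - c z')); last by ring.
  by apply: le_trans (ler_normB _ _) _; rewrite [e]splitr addrC lerD.
move=> [n _ /(_ n (leqnn n)) h]; exists n.+1%:R^-1; first by rewrite invr_gt0.
by move=> z z' Kz Kz'; exact: h.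
Qed.

Definition cost_ext (z : d.-tuple R * d.-tuple R) : R :=
  ((fun z => c (toRow z.1, toRow z.2)) \_ ((@toRow R d @^-1` Xm) `*` (@toRow R d @^-1` Xp))) z.

Lemma cost_ext_step : step_approximable cost_ext.
Proof.
move=> e e0; have [r r0 hr] := heine e0.
have r20 : 0 < r / 2 by rewrite divr_gt0.
have [sm [_ smP]] := finite_ball_cover cXm r20; have [sp [_ spP]] := finite_ball_cover cXp r20.
(* The support itself is one of the generating sets, so no cell straddles its boundary, where the
   extension by zero may jump. *)
pose B (X : set 'rV[R]_d) s : seq (set (d.-tuple R)) :=
  (@toRow R d @^-1` X) :: [seq @toRow R d @^-1` ball y (r / 2) | y <- s].
have mB X s : compact X -> forall k, (k < size (B X s))%N -> measurable (nth set0 (B X s) k).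
  move=> cX [_|k]; first exact: measurable_compact_row.
  rewrite /= ltnS size_map => ks; rewrite (nth_map 0)//; exact: measurable_ball_row.
pose cell1 := @atom _ _ (B Xm sm); pose cell2 := @atom _ _ (B Xp sp).
(* The value at a chosen point of the cell, and [0] on an empty cell. *)
pose S i j : R := if pselect (exists z, cell1 z.1 = i /\ cell2 z.2 = j) is left h
  then cost_ext (projT1 (cid h)) else 0.
exists _, _, cell1, cell2, S; split.
- by move=> i; apply: measurable_atom; exact: mB.
- by move=> i; apply: measurable_atom; exact: mB.
move=> z; rewrite /S; case: pselect => [h|[]]; last by exists z.
case: cid => w /= [e1 e2].
have inX A s x x' : @atom _ _ (B A s) x = @atom _ _ (B A s) x' -> A (toRow x) -> A (toRow x').
  by move=> exx'; exact: (@atom_eq _ _ (B A s) x x' 0 exx').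
have close A s x x' : (forall x, A x -> exists2 y, y \in s & ball y (r / 2) x) ->
    @atom _ _ (B A s) x = @atom _ _ (B A s) x' -> A (toRow x) -> ball (toRow x) r (toRow x').
  move=> sP exx' Ax; have [y ys yx] := sP _ Ax.
  have ks : ((index y s).+1 < size (B A s))%N by rewrite /= ltnS size_map index_mem.
  have yx' := atom_eq exx' ks; rewrite /= (nth_map 0) ?index_mem// nth_index// in yx'.
  by rewrite [r]splitr; apply: ball_triangle (yx' yx); exact: ball_sym.
rewrite /cost_ext !patchE; case: ifPn => hz.
  move: hz; rewrite inE => -[z1 z2].
  have w1 := inX _ _ _ _ (esym e1) z1; have w2 := inX _ _ _ _ (esym e2) z2.
  rewrite mem_set //; apply: hr => //=; split; first exact: close smP (esym e1) z1.
  exact: close spP (esym e2) z2.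
move: hz; rewrite notin_setE => nz.
rewrite memNset ?subrr ?normr0 ?ltW// => -[w1 w2]; apply: nz.
by split; [exact: (inX _ _ _ _ e1)|exact: (inX _ _ _ _ e2)].
Qed.

End cost_approximation.

(** A uniform limit of finite step functions: measurability passes to the limit, and the approximant
    at precision [1] gives the bound. *)
Lemma bm_step_approximable {R : realType} d1 d2 (T1 : measurableType d1) (T2 : measurableType d2)
  (c : T1 * T2 -> R) : step_approximable c -> bm c.
Proof.
move=> h; have n0 n : 0 < n.+1%:R^-1 :> R by rewrite invr_gt0.
have hn n : exists s : T1 * T2 -> R, bm s /\ forall z, `|c z - s z| <= n.+1%:R^-1.
  have [I [J [cell1 [cell2 [S [m1 m2 cS]]]]]] := h _ (n0 n).
  exists (fun z => S (cell1 z.1) (cell2 z.2)); split => //.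
  pose cell (z : T1 * T2) := (cell1 z.1, cell2 z.2).
  apply: (@bm_cell R _ (T1 * T2)%type _ cell _ (fun ij => S ij.1 ij.2)) => ij.
  have -> : cell @^-1` [set ij] = (cell1 @^-1` [set ij.1]) `*` (cell2 @^-1` [set ij.2]).
    by case: ij => i j; apply/seteqP; split=> -[x y] /=; [move=> [<- <-]|move=> [<- <-]].
  exact: measurableX.
pose s n := projT1 (cid (hn n)).
have sP n : bm (s n) /\ forall z, `|c z - s n z| <= n.+1%:R^-1 by exact: projT2 (cid (hn n)).
split; last first.
  have [[_ [M sM]] cs] := sP 0%N; exists (1 + M) => z.
  rewrite -(subrK (s 0%N z) (c z)); apply: le_trans (ler_normD _ _) _; apply: lerD => //.
  by apply: le_trans (cs z) _; rewrite invr1.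
apply: (@measurable_fun_cvg _ _ _ _ (fun n z => s n z)) => [n|z _].
  by have [[]] := sP n.
apply: (@cvg_of_bound _ _ (fun n => n.+1%:R^-1)); last exact: cvg_harmonic.
by move=> n; rewrite distrC; exact: (sP n).2.
Qed.

Theorem theorem2p1 (R : realType) (d : nat)
    (mum mup : probability (d.-tuple R) R)
    (Xm Xp : set 'rV[R]_d) (c : 'rV[R]_d * 'rV[R]_d -> R) :
  Xm = msupport mum -> Xp = msupport mup ->
  compact Xm -> compact Xp ->
  {within Xm `*` Xp, continuous c} ->
  (forall eps : R, 0 <= eps -> v_fun mum mup Xm Xp c eps \is a fin_num) /\
  {within [set eps : R | 0 <= eps],
     continuous (fun eps => fine (v_fun mum mup Xm Xp c eps))} /\
  nondecreasing_on (fun eps => fine (v_fun mum mup Xm Xp c eps))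
    [set eps : R | 0 <= eps] /\
  concave_on (fun eps => fine (v_fun mum mup Xm Xp c eps))
    [set eps : R | 0 <= eps] /\
  analytic_on (fun eps => fine (v_fun mum mup Xm Xp c eps))
    [set eps : R | 0 < eps].
Proof.
move=> _ _ cXm cXp cc.
have step := cost_ext_step cXm cXp cc; have bc := bm_step_approximable step.
pose ct := cost_ext Xm Xp c.
have costE g : cost Xm Xp c g = (E g ct)%:E.
  rewrite /cost integral_mkcond -bm_fin//; apply: eq_integral => z _.
  by rewrite /ct /cost_ext !patchE; case: ifP.
have vE eps : v_fun mum mup Xm Xp c eps = value mum mup ct eps.
  rewrite /v_fun; case: eqP => [->|_]; rewrite /value; congr ereal_inf.
    apply/seteqP; split=> _ [g mg <-]; exists g => //.
      by rewrite /objective mul0e adde0 costE.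
    by rewrite /objective mul0e adde0 costE.
  by apply/seteqP; split=> _ [g mg <-]; exists g => //; rewrite /objective costE.
have -> : (fun eps => fine (v_fun mum mup Xm Xp c eps)) = rvalue mum mup ct.
  by apply: funext => eps; rewrite vE.
have nd : nondecreasing_on (rvalue mum mup ct) [set eps : R | 0 <= eps].
  by move=> x y /= x0 y0 xy; exact: rvalue_nondecreasing.
have co : concave_on (rvalue mum mup ct) [set eps : R | 0 <= eps].
  by move=> x y t /= x0 y0 t01; exact: rvalue_concave.
split; first by move=> eps e0; rewrite vE value_fin.
split; last by split => //; split => //; exact: rvalue_analytic.
apply: concave_continuous => // e e0; exact: rvalue_right0.
Qed.
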